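(* The group $H=\{f\in P_+\mid \text{there exists } p\in\mathbb N \text{ such that } f(t+p)=f(t)+p \text{ for all } t\in\mathbb R\}$, under composition, is simple.
   Context: $\mathbb N=\{1,2,3,\dots\}$. $P_+$ is the group, under composition, of all orientation-preserving homeomorphisms $f:\mathbb R\to\mathbb R$ that are piecewise linear with a discrete (possibly infinite) set of breakpoints, all of which are dyadic rationals (elements of $\mathbb Z[1/2]$), whose slopes are integer powers of $2$ (that is, $2^k$ with $k\in\mathbb Z$), and which satisfy $f(\mathbb Z[1/2])=\mathbb Z[1/2]$. *)

(* Defs.v *)
From HB Require Import structures.
From mathcomp Require Import all_boot all_order all_algebra.
From mathcomp Require Import all_classical all_reals topology normedtype.
Import Order.TTheory GRing.Theory Num.Theory.
Import numFieldNormedType.Exports.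

Set Implicit Arguments.
Unset Strict Implicit.
Unset Printing Implicit Defensive.

Local Open Scope classical_set_scope.
Local Open Scope ring_scope.

Definition normal_subgroup (G : groupType) (N : set G) : Prop :=
  group_closed [in N] /\ (forall x g : G, N x -> N (x ^ g)%g).

Definition simple_group (G : groupType) : Prop :=
  (exists x : G, x <> 1%g) /\
  (forall N : set G, normal_subgroup N -> N = [set 1%g] \/ N = [set: G]).

Section Homeo.
Variable T : topologicalType.

Record homeo := Homeo {
  homeo_fun :> T -> T;
  homeo_inv : T -> T;
  homeoK : cancel homeo_fun homeo_inv;
  homeoVK : cancel homeo_inv homeo_fun;
  homeo_continuous : continuous homeo_fun;
  homeo_inv_continuous : continuous homeo_inv }.

Lemma homeo_ext (f g : homeo) : f =1 g -> f = g.
Proof.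
case: f => f f' fK f'K cf cf'; case: g => g g' gK g'K cg cg' /= fg.
have efg : f = g by apply/funext.
subst g; have ef' : f' = g' by apply/funext => x; rewrite -{1}(g'K x) fK.
subst g'; congr Homeo; exact: Prop_irrelevance.
Qed.

HB.instance Definition _ := gen_eqMixin homeo.
HB.instance Definition _ := gen_choiceMixin homeo.

Definition homeo1 : homeo.
Proof. by apply: (@Homeo id id) => // x; exact: cvg_id. Defined.

Definition homeoV (f : homeo) : homeo :=
  Homeo (homeoVK f) (homeoK f) (@homeo_inv_continuous f) (@homeo_continuous f).

Definition homeoM (f g : homeo) : homeo.
Proof.
apply: (@Homeo (f \o g) (homeo_inv g \o homeo_inv f)).
- exact: can_comp (homeoK f) (homeoK g).
- exact: can_comp (homeoVK g) (homeoVK f).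
- by move=> x; apply: continuous_comp; exact: homeo_continuous.
- by move=> x; apply: continuous_comp; exact: homeo_inv_continuous.
Defined.

Lemma homeoMA : associative homeoM. Proof. by move=> f g h; exact: homeo_ext. Qed.
Lemma homeo1M : left_id homeo1 homeoM. Proof. by move=> f; exact: homeo_ext. Qed.
Lemma homeoM1 : right_id homeo1 homeoM. Proof. by move=> f; exact: homeo_ext. Qed.
Lemma homeoVM : left_inverse homeo1 homeoV homeoM.
Proof. by move=> f; apply: homeo_ext => x /=; rewrite homeoK. Qed.
Lemma homeoMV : right_inverse homeo1 homeoV homeoM.
Proof. by move=> f; apply: homeo_ext => x /=; rewrite homeoVK. Qed.

HB.instance Definition _ :=
  isGroup.Build homeo homeoMA homeo1M homeoM1 homeoVM homeoMV.

End Homeo.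

Section PiecewiseLinear.
Variable R : realType.
Implicit Types (f : R -> R) (a x y : R).

Definition affine_near f a x :=
  exists b, \forall y \near x, f y = a * y + b.

(* A breakpoint of [f] is a point having no neighbourhood on which [f] is affine.
   So [f] is affine on each component of the complement of [breakpoints f]; and
   as [breakpoints f] is closed, requiring all its points to be isolated makes
   it locally finite, so that it cannot accumulate anywhere. *)
Definition breakpoints f : set R := [set x | ~ exists a, affine_near f a x].

Definition dyadic : set R :=
  [set x | exists (m : int) (n : nat), x = m%:~R / 2 ^+ n].

Record is_Pplus (f : homeo R) : Prop := IsPplus {
  Pplus_increasing : {homo f : x y / x < y};
  Pplus_discrete : breakpoints f `<=` isolated (breakpoints f);
  Pplus_breakpoints : breakpoints f `<=` dyadic;
  Pplus_slope : forall a x, affine_near f a x -> exists k : int, a = 2 ^ k;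
  Pplus_dyadic : f @` dyadic = dyadic }.

Lemma affine_near_near f a x :
  affine_near f a x -> \forall y \near x, affine_near f a y.
Proof.
move=> [b] /nbhs_interior h; near=> y; exists b.
by near: y; move: h; exact.
Unshelve. all: by end_near. Qed.

Lemma affine_near_uniq f a a' x :
  affine_near f a x -> affine_near f a' x -> a = a'.
Proof.
move=> [b h] [b' h'].
have /nbhs_ballP[e /= e0 H] : nbhs x [set y | a * y + b = a' * y + b'].
  by apply: filterS2 h h' => y /= <- <-.
have H1 : a * x + b = a' * x + b' by apply: H; exact: ballxx.
have H2 : a * (x + e / 2) + b = a' * (x + e / 2) + b'.
  apply: H; rewrite /ball /= opprD addrA subrr add0r normrN gtr0_norm.
    by rewrite ltr_pdivrMr // ltr_pMr // ltr1n.
  exact: divr_gt0.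
have : (a - a') * (e / 2) = 0.
  rewrite !mulrDr in H2; rewrite mulrBl; apply/eqP; rewrite subr_eq0; apply/eqP.
  by apply: (addrI (a * x + b)); rewrite addrAC H2 {1}H1 addrAC.
move/eqP; rewrite mulf_eq0 subr_eq0 => /orP[/eqP//|].
by rewrite (gt_eqF (divr_gt0 e0 _)).
Qed.

Lemma affine_near_comp f g a c x : {for x, continuous g} ->
  affine_near f a (g x) -> affine_near g c x -> affine_near (f \o g) (a * c) x.
Proof.
move=> cg [b hf] [d hg]; exists (a * d + b).
have hfg : \forall y \near x, f (g y) = a * g y + b by exact: cg hf.
apply: filterS2 hfg hg => y /= -> ->.
by rewrite mulrDr mulrA addrA.
Qed.

Lemma affine_near_inv (f : homeo R) a x :
  affine_near (homeo_inv f) a x -> affine_near f a^-1 (homeo_inv f x).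
Proof.
move=> [b h].
have a0 : a != 0.
  apply/eqP => a0; have /nbhs_ballP[e /= e0 H] := h.
  have H1 : homeo_inv f x = b by rewrite (H x (ballxx _ e0)) a0 mul0r add0r.
  have H2 : homeo_inv f (x + e / 2) = b.
    rewrite (H (x + e / 2)) ?a0 ?mul0r ?add0r // /ball /=.
    rewrite opprD addrA subrr add0r normrN gtr0_norm ?divr_gt0 //.
    by rewrite ltr_pdivrMr // ltr_pMr // ltr1n.
  have /eqP := can_inj (homeoVK f) (etrans H2 (esym H1)).
  by rewrite -subr_eq0 addrAC subrr add0r (gt_eqF (divr_gt0 e0 _)).
have h' : \forall y \near f (homeo_inv f x), homeo_inv f y = a * y + b.
  by rewrite homeoVK.
exists (- (a^-1 * b)); have h2 : \forall z \near homeo_inv f x, homeo_inv f (f z) = a * f z + b.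
  exact: (@homeo_continuous _ f _ _ h').
apply: filterS h2 => z /= E.
rewrite homeoK in E; have Ez : a * f z = z - b by rewrite {2}E addrK.
by rewrite -mulrN -mulrDr -Ez mulKf.
Qed.

Lemma discreteP f : breakpoints f `<=` isolated (breakpoints f) <->
  forall x, \forall y \near x^', exists a, affine_near f a y.
Proof.
split=> [h x|h x bx].
  have [[a /affine_near_near fx]|/h[_ [V xV VB]]] :=
    pselect (exists a, affine_near f a x).
    by apply: nbhs_dnbhs; apply: filterS fx => y; exists a.
  suff: \forall y \near x, y != x -> exists a, affine_near f a y by [].
  apply: filterS xV => y Vy yx.
  apply: contrapT => By; have : (V `&` breakpoints f) y by [].
  by rewrite VB; apply/eqP.
split; first exact/mem_set.
exists ([set x] `|` [set y | exists a, affine_near f a y]).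
  have hx : \forall y \near x, y != x -> exists a, affine_near f a y := h x.
  apply: filterS hx => y hy; by have [->|/hy] := eqVneq y x; [left|right].
by apply/seteqP; split => [y [[//|?] By]|_ ->]; [|split => //; left].
Qed.

Lemma dnbhs_homeo (f : homeo R) (P : set R) x :
  (\forall y \near (f x)^', P y) -> \forall y \near x^', P (f y).
Proof.
rewrite /dnbhs => h.
have {}h : \forall y \near x, f y != f x -> P (f y).
  exact: (@homeo_continuous _ f x _ h).
apply: filterS h => y /= hy yx.
by apply: hy; apply: contra_neq yx => /(can_inj (homeoK f)).
Qed.

Lemma dyadic_mem (f : homeo R) : f @` dyadic = dyadic ->
  forall x, dyadic (f x) <-> dyadic x.
Proof.
move=> fD x; split=> [|Dx]; last by rewrite -fD; exists x.
by rewrite -{1}fD => -[y Dy /(can_inj (homeoK f)) <-].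
Qed.

Lemma is_Pplus1 : is_Pplus 1%g.
Proof.
have A x : affine_near (homeo1 R) 1 x.
  by exists 0; near=> y; rewrite /= mul1r addr0.
have B x : ~ breakpoints (homeo1 R) x by move=> [//]; exists 1.
split.
- by [].
- by move=> x /B.
- by move=> x /B.
- by move=> a x /affine_near_uniq -/(_ _ (A x)) ->; exists 0; rewrite expr0z.
- exact: image_id.
Unshelve. all: by end_near. Qed.

Lemma is_PplusM (f g : homeo R) : is_Pplus f -> is_Pplus g -> is_Pplus (f * g)%g.
Proof.
move=> [fi fd fb fs fD] [gi gd gb gs gD].
have D : forall x, \forall y \near x^', exists a c,
    [/\ affine_near f a (g y), affine_near g c y & affine_near (f \o g) (a * c) y].
  move/discreteP: fd => fd; move/discreteP: gd => gd x.
  apply: filterS2 (dnbhs_homeo (fd (g x))) (gd x) => y [a fa] [c gc].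
  exists a, c; split => //.
  by apply: affine_near_comp => //; exact: homeo_continuous.
split.
- by move=> x y /gi /fi.
- apply/discreteP => x; apply: filterS (D x) => y [a [c [_ _ h]]].
  by exists (a * c).
- move=> x Bx; have [[c gc]|/gb//] := pselect (exists c, affine_near g c x).
  have [[a fa]|/fb] := pselect (exists a, affine_near f a (g x)).
    case: Bx; exists (a * c); apply: affine_near_comp => //.
    exact: homeo_continuous.
  by move/(dyadic_mem gD).
- move=> a x /affine_near_near h.
  have [y [[c [d [hc hd hcd]]] hy]] : exists y, (exists c d,
    [/\ affine_near f c (g y), affine_near g d y &
      affine_near (f \o g) (c * d) y]) /\ affine_near (f \o g) a y.
    apply: (@filter_ex _ x^'); apply: filterS2 (D x) (nbhs_dnbhs h) => y.
    by split.
  have [k ck] := fs _ _ hc; have [l dl] := gs _ _ hd.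
  exists (k + l); rewrite (affine_near_uniq hy hcd) ck dl expfzDr //.
  by rewrite pnatr_eq0.
- by rewrite -[LHS]/((f \o g) @` dyadic) -image_comp gD fD.
Qed.

Lemma is_PplusV (f : homeo R) : is_Pplus f -> is_Pplus f^-1%g.
Proof.
move=> [fi fd fb fs fD].
have A a x : affine_near f a x -> affine_near (homeo_inv f) a^-1 (f x).
  by move=> h; apply: (@affine_near_inv (homeoV f)) => /=.
split.
- move=> x y xy /=; rewrite ltNge; apply/negP; rewrite le_eqVlt => /orP[/eqP|/fi].
    by move/(can_inj (homeoVK f)) => e; rewrite e ltxx in xy.
  by rewrite !homeoVK ltNge (ltW xy).
- move/discreteP: fd => fd; apply/discreteP => x.
  have := @dnbhs_homeo (homeoV f) _ x (fd (homeo_inv f x)).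
  apply: filterS => y [a /A]; rewrite homeoVK; by exists a^-1.
- move=> x Bx; rewrite -(homeoVK f x); apply/(dyadic_mem fD)/fb => -[a /A].
  by rewrite homeoVK => h; apply: Bx; exists a^-1.
- move=> a x /affine_near_inv/fs[k ak]; exists (- k).
  by rewrite -invr_expz -ak invrK.
- apply/seteqP; split=> [_ [x Dx <-]|x Dx].
    by apply/(dyadic_mem fD); rewrite /= homeoVK.
  by exists (f x); [apply/(dyadic_mem fD)|rewrite /= homeoK].
Qed.

Definition in_Pplus : {pred homeo R} := [pred f | `[< is_Pplus f >]].

Lemma Pplus_closed : group_closed in_Pplus.
Proof.
split; first exact/asboolP/is_Pplus1.
by move=> f g /asboolP Pf /asboolP Pg; apply/asboolP/is_PplusM/is_PplusV.
Qed.

Record Pplus := MkPplus {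
  Pplus_homeo :> homeo R;
  Pplus_homeoP : in_Pplus Pplus_homeo }.

HB.instance Definition _ := [isSub for Pplus_homeo].
HB.instance Definition _ := [Choice of Pplus by <:].
HB.instance Definition _ :=
  SubChoice_isSubGroup.Build (homeo R) in_Pplus Pplus Pplus_closed.

(* The period [p] ranges over the positive integers and depends on [f]. *)
Definition in_Hper : {pred Pplus} := [pred f : Pplus |
  `[< exists2 p : nat, (0 < p)%N & forall t, f (t + p%:R) = f t + p%:R >]].

Lemma Hper_closed : group_closed in_Hper.
Proof.
have shift (f : Pplus) p : (forall t, f (t + p%:R) = f t + p%:R) ->
    forall k t, f (t + (k * p)%:R) = f t + (k * p)%:R.
  move=> h; elim=> [|k IH] t; first by rewrite mul0n !addr0.
  by rewrite mulSn natrD !addrA IH h.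
split; first by apply/asboolP; exists 1%N.
move=> f g /asboolP[p p0 /shift fp] /asboolP[q q0 /shift gq]; apply/asboolP.
exists (p * q)%N; first by rewrite muln_gt0 p0.
move=> t; have E u : (f / g)%g u = f (homeo_inv g u) by [].
rewrite !E -[(p * q)%N in RHS]mulnC -fp; congr (f _).
by apply: (can_inj (homeoK g)); rewrite [(q * p)%N]mulnC gq !homeoVK.
Qed.

Record Hper := MkHper { Hper_Pplus :> Pplus; Hper_PplusP : in_Hper Hper_Pplus }.

HB.instance Definition _ := [isSub for Hper_Pplus].
HB.instance Definition _ := [Choice of Hper by <:].
HB.instance Definition _ :=
  SubChoice_isSubGroup.Build Pplus in_Hper Hper Hper_closed.

End PiecewiseLinear.

(* Main.v *)
Require Import Defs.
From mathcomp Require Import all_boot all_order all_algebra.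
From mathcomp Require Import all_classical all_reals topology normedtype.
From mathcomp Require Import ring lra zify.
Import Order.TTheory GRing.Theory Num.Theory.
Import numFieldNormedType.Exports.

(* Let N be a normal subgroup containing some f0 <> 1, let f be in H, and let q be
   a common period of f and f0, so large that 0 < |f0 x - x| < q for some x
   (periods may be replaced by their multiples, which is why no translation is an
   obstruction).  Then f0 displaces a small interval modulo q.  The usual commutator trick
   then shows that elements of period q supported in a common interval of length
   1/2 commute modulo N.

   The swap of lengths u, v with v / u a power of 2 maps two adjacent intervals of
   lengths u, v affinely onto intervals of lengths v, u.  The class modulo N of a
   small swap depends only on v / u, and relations between swaps force all these
   classes to be trivial.

   If f fixes 0, then on a fine dyadic grid f is given by two sequences of powers
   of 2, the lengths of the cells and those of their images, with the same sum over
   a period.  Composing with swaps permutes the cells or their images; halving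
   cells and exchanging images turns more and more of f into translations, until
   f = 1.  So f is in N; then so are the dyadic translations, and hence all of H. *)

Set Implicit Arguments.
Unset Strict Implicit.
Unset Printing Implicit Defensive.

Local Open Scope classical_set_scope.
Local Open Scope ring_scope.

(** * Elements of P_+ *)

Section Dyadic.
Variable R : realType.
Implicit Types (a x y : R) (k : int).

Lemma dyadicD x y : dyadic x -> dyadic y -> dyadic (x + y).
Proof.
move=> [m [n ->]] [m' [n' ->]].
exists (m * 2 ^+ n' + m' * 2 ^+ n)%R, (n + n')%N.
rewrite rmorphD !rmorphM !rmorphXn /= exprD.
have h j : (2 : R) ^+ j != 0 by rewrite expf_neq0 ?pnatr_eq0.
by field; rewrite ?h.
Qed.

Lemma dyadicN x : dyadic x -> dyadic (- x).
Proof. by move=> [m [n ->]]; exists (- m), n; rewrite rmorphN mulNr. Qed.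

Lemma dyadicB x y : dyadic x -> dyadic y -> dyadic (x - y).
Proof. by move=> Dx /dyadicN; exact: dyadicD. Qed.

Lemma dyadicM x y : dyadic x -> dyadic y -> dyadic (x * y).
Proof.
move=> [m [n ->]] [m' [n' ->]]; exists (m * m'), (n + n')%N.
have h j : (2 : R) ^+ j != 0 by rewrite expf_neq0 ?pnatr_eq0.
by rewrite rmorphM /= exprD; field; rewrite !h.
Qed.

Lemma dyadic_int k : dyadic (k%:~R : R).
Proof. by exists k, 0%N; rewrite expr0 divr1. Qed.

Lemma dyadic0 : dyadic (0 : R). Proof. exact: (dyadic_int 0). Qed.

Lemma dyadic_nat n : dyadic (n%:R : R).
Proof. exact: (dyadic_int (Posz n)). Qed.

Lemma exp2_gt0 k : (0 : R) < 2 ^ k. Proof. exact: exprz_gt0. Qed.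
Lemma exp2D k k' : (2 : R) ^ (k + k') = 2 ^ k * 2 ^ k'.
Proof. by rewrite expfzDr// pnatr_eq0. Qed.

Lemma dyadic_exp2 k : dyadic ((2 : R) ^ k).
Proof.
case: k => n; first by exists (2 ^+ n), 0%N; rewrite rmorphXn /= expr0 divr1.
by exists 1, n.+1; rewrite NegzE /= mul1r.
Qed.

Lemma dyadic_exp2V n : dyadic (2 ^- n : R).
Proof. by exists 1, n; rewrite mul1r. Qed.

Lemma dyadic_half : dyadic (2^-1 : R). Proof. exact: (dyadic_exp2 (-1)). Qed.

Lemma dyadic_exp2M k x : dyadic (2 ^ k * x) <-> dyadic x.
Proof.
split=> [h|]; last by apply: dyadicM; exact: dyadic_exp2.
have -> : x = 2 ^ (- k) * (2 ^ k * x) by rewrite mulrA -exp2D addNr mul1r.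
by apply: dyadicM => //; exact: dyadic_exp2.
Qed.

Lemma dyadic_addl a x : dyadic a -> dyadic (a + x) <-> dyadic x.
Proof.
move=> Da; split=> [h|]; last exact: dyadicD.
by have -> : x = a + x - a by [ring]; exact: dyadicB.
Qed.

Lemma dyadic_dense x y : x < y -> exists2 d, dyadic d & x < d < y.
Proof.
move=> xy; have e0 : 0 < y - x by rewrite subr_gt0.
have [n hn] : exists n : nat, (y - x)^-1 < 2 ^+ n.
  exists (Num.bound (y - x)^-1).
  rewrite (lt_le_trans (archi_boundP _)) ?invr_ge0 ?(ltW e0)//.
  by rewrite -natrX ler_nat ltnW// ltn_expl.
have p0 : (0 : R) < 2 ^+ n by rewrite exprn_gt0.
have [/= h1 h2] := andP (floor_itv (2 ^+ n * x)).
exists ((Num.floor (2 ^+ n * x) + 1)%:~R / 2 ^+ n).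
  by exists (Num.floor (2 ^+ n * x) + 1), n.
rewrite ltr_pdivlMr// ltr_pdivrMr// mulrC h2 /=.
have h3 : 1 < 2 ^+ n * (y - x) by rewrite -ltr_pdivrMr// div1r.
rewrite rmorphD /= (le_lt_trans (lerD h1 (lexx _)))//.
by move: h3; rewrite mulrBr mulrC; lra.
Qed.

Lemma exp2_small (e : R) : 0 < e -> exists n : nat, 2 ^- n < e.
Proof.
move=> /dyadic_dense[_ [m [n ->]] /andP[c0 ce]]; exists n.
apply: le_lt_trans ce; rewrite -[leLHS]mul1r ler_pM2r ?invr_gt0 ?exprn_gt0//.
move: c0; rewrite pmulr_lgt0 ?invr_gt0 ?exprn_gt0// ltr0z => m0.
by rewrite -[1]/(1%:~R) ler_int -gtz0_ge1.
Qed.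

End Dyadic.

(** * Local criterion for membership in [P_+]; kinks and translations *)

Section PplusExamples.
Variable R : realType.
Implicit Types (a b c d t u v x y : R) (f g : homeo R) (k : int).

Lemma eq_near_affine (f g : R -> R) a x : (\forall y \near x, f y = g y) ->
  affine_near f a x -> affine_near g a x.
Proof. by move=> h [b fb]; exists b; apply: filterS2 h fb => y <-. Qed.

Lemma dyadic_image f : (forall x, dyadic (f x) <-> dyadic x) -> f @` @dyadic R = @dyadic R.
Proof.
move=> D; apply/seteqP; split=> [_ [x Dx <-]|x Dx]; first exact/D.
by exists (homeo_inv f x); [apply/D; rewrite homeoVK|rewrite homeoVK].
Qed.

(** Breakpoints, slopes and dyadic values are local data. This lets a periodization, which has
    infinitely many pieces, be compared near each point with a finite product of elements of
    [P_+]. *)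
Lemma is_Pplus_local f : {homo f : x y / x < y} ->
  (forall x, exists2 g : homeo R, is_Pplus g & \forall y \near x, f y = g y) ->
  is_Pplus f.
Proof.
move=> fi fl.
have D x : dyadic (f x) <-> dyadic x.
  have [g [_ _ _ _ gD] fg] := fl x.
  by rewrite (nbhs_singleton fg); exact: dyadic_mem.
split=> //.
- apply/discreteP => x; have [g [_ gd _ _ _] fg] := fl x.
  move/discreteP: gd => /(_ x) gd.
  have := nbhs_dnbhs (near_join fg); apply: filterS2 gd => y [a ga] h.
  by exists a; apply: eq_near_affine ga; apply: filterS h => z ->.
- move=> x Bx; have [g [_ _ gb _ _] fg] := fl x; apply: gb => -[a ga].
  by apply: Bx; exists a; apply: eq_near_affine ga; apply: filterS fg => z ->.
- move=> a x fa; have [g [_ _ _ gs _] fg] := fl x.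
  exact: gs (eq_near_affine fg fa).
- exact: dyadic_image.
Qed.

Section Kink.
Variables (c : R) (k : int).

(** The identity up to [c], then slope [2 ^ k]; writing it with a maximum gives continuity without
    gluing. *)
Definition kinkf t := t + (2 ^ k - 1) * Num.max 0 (t - c).

Lemma kinkf_le t : t <= c -> kinkf t = t.
Proof. by rewrite -subr_le0 /kinkf => /max_idPl ->; ring. Qed.

Lemma kinkf_ge t : c <= t -> kinkf t = c + 2 ^ k * (t - c).
Proof. by rewrite -subr_ge0 /kinkf => /max_idPr ->; ring. Qed.

Lemma kinkf_continuous : continuous kinkf.
Proof.
move=> t; apply: cvgD; first exact: cvg_id.
apply: cvgM; first exact: cvg_cst.
apply: (@continuous_max _ _ (fun=> 0) (fun s => s - c)); first exact: cvg_cst.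
by apply: cvgB; [exact: cvg_id|exact: cvg_cst].
Qed.

End Kink.

Lemma kinkfK c k : cancel (kinkf c k) (kinkf c (- k)).
Proof.
move=> t; have [h|/ltW h] := leP t c; first by rewrite !kinkf_le.
rewrite (kinkf_ge _ h) kinkf_ge; last first.
  by rewrite lerDl mulr_ge0 ?subr_ge0// ltW// exp2_gt0.
by rewrite addrAC subrr add0r mulrA -exp2D addNr mul1r addrC subrK.
Qed.

Definition kink c k : homeo R.
Proof.
apply: (@Homeo _ (kinkf c k) (kinkf c (- k))).
- exact: kinkfK.
- by have := kinkfK c (- k); rewrite opprK.
- exact: kinkf_continuous.
- exact: kinkf_continuous.
Defined.

Lemma kink_affine_lt c k x : x < c -> affine_near (kink c k) 1 x.
Proof.
move=> xc; exists 0; near=> y; rewrite /= kinkf_le ?mul1r ?addr0//.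
by apply/ltW; near: y; exact: lt_nbhsl.
Unshelve. all: by end_near. Qed.

Lemma kink_affine_gt c k x : c < x -> affine_near (kink c k) (2 ^ k) x.
Proof.
move=> xc; exists (c - 2 ^ k * c); near=> y; rewrite /= kinkf_ge; first by ring.
by apply/ltW; near: y; exact: lt_nbhsr.
Unshelve. all: by end_near. Qed.

Lemma kink_Pplus c k : dyadic c -> is_Pplus (kink c k).
Proof.
move=> Dc; have k0 := exp2_gt0 R k.
have A x : x != c -> exists i : int, affine_near (kink c k) (2 ^ i) x.
  rewrite neq_lt => /orP[/(kink_affine_lt k)|/(kink_affine_gt k)] h.
    by exists 0; rewrite ?expr0z.
  by exists k.
have B x : breakpoints (kink c k) x -> x = c.
  move=> Bx; apply/eqP; apply: contraT => /A[i h].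
  by case: Bx; exists (2 ^ i).
split.
- move=> x y xy /=; have [yc|cy] := leP y c.
    by rewrite !kinkf_le// (le_trans (ltW xy)).
  rewrite (kinkf_ge _ (ltW cy)); have [xc|/ltW cx] := leP x c.
    rewrite kinkf_le// (le_lt_trans xc)// ltrDl mulr_gt0//; lra.
  by rewrite kinkf_ge// ltrD2l ltr_pM2l// ltrD2r.
- apply/discreteP => x; have [->|/A[i /affine_near_near h]] := eqVneq x c.
    suff: \forall y \near c, y != c -> exists a, affine_near (kink c k) a y by [].
    by apply: (@filterE _ (nbhs c)) => y /A[i h]; exists (2 ^ i).
  by apply: nbhs_dnbhs; apply: filterS h => y hy; exists (2 ^ i).
- by move=> x /B ->.
(* If [kink] is affine near [c] itself, as for [k = 0], the slope there is read off at a nearby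
   point other than [c]. *)
- move=> a x ax; have := nbhs_dnbhs (affine_near_near ax) => h.
  have [y [ay yx]] : exists y, affine_near (kink c k) a y /\ y != c.
    have [xc|xc] := eqVneq x c; last by exists x.
    rewrite xc in h; apply: (@filter_ex _ c^').
    have hc : \forall y \near c^', y != c by exact: (near_withinT _ (nbhs_filter c)).
    by apply: filterS2 h hc => y ? ?; split.
  by have [i /(affine_near_uniq ay) ->] := A _ yx; exists i.
have E x : dyadic (kink c k x) <-> dyadic x.
  rewrite /=; have [xc|/ltW cx] := leP x c; first by rewrite kinkf_le.
  rewrite kinkf_ge// dyadic_addl// dyadic_exp2M addrC dyadic_addl//.
  exact: dyadicN.
exact: dyadic_image.
Qed.

Definition transl d : homeo R.
Proof.
apply: (@Homeo _ (fun t => t + d) (fun t => t - d)).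
- by move=> t; rewrite addrK.
- by move=> t; rewrite subrK.
- by move=> t; apply: cvgD; [exact: cvg_id|exact: cvg_cst].
- by move=> t; apply: cvgB; [exact: cvg_id|exact: cvg_cst].
Defined.

Lemma transl_Pplus d : dyadic d -> is_Pplus (transl d).
Proof.
move=> Dd.
have A x : affine_near (transl d) 1 x.
  by exists d; near=> y; rewrite /= mul1r.
have B x : ~ breakpoints (transl d) x by move=> [//]; exists 1.
split.
- by move=> x y; rewrite /= ltrD2r.
- by move=> x /B.
- by move=> x /B.
- by move=> a x /affine_near_uniq -/(_ _ (A x)) ->; exists 0; rewrite expr0z.
have E x : dyadic (transl d x) <-> dyadic x by rewrite /= addrC dyadic_addl.
exact: dyadic_image.
Unshelve. all: by end_near. Qed.

End PplusExamples.

(** * Periodization *)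

Section Periodize.
Variables (R : realType) (a q : R).
Hypothesis q_gt0 : 0 < q.
Implicit Types (t : R) (n : int).

Let cell t : R := (Num.floor ((t - a) / q))%:~R.

(** Only the values of [g] on [[a, a + q)] enter; they are repeated on every translate of this
    cell. *)
Definition periodize (g : R -> R) t := g (t - cell t * q) + cell t * q.

Definition supported_cell (g : R -> R) := forall t, t <= a \/ a + q <= t -> g t = t.

Lemma cell_itv t : a + cell t * q <= t < a + (cell t + 1) * q.
Proof.
have /andP[h1 h2] := floor_itv ((t - a) / q).
rewrite addrC -lerBrDr -ler_pdivlMr// h1 addrC -ltrBlDr -ltr_pdivrMr//.
by rewrite intrD in h2.
Qed.

Lemma cell_uniq n t : a + n%:~R * q <= t < a + (n%:~R + 1) * q -> cell t = n%:~R.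
Proof.
move=> /andP[h1 h2]; rewrite /cell (@floor_def _ _ n)// intrD.
by rewrite ler_pdivlMr// ltr_pdivrMr// lerBrDr ltrBlDr addrC h1 addrC h2.
Qed.

Lemma periodizeE g n t : a + n%:~R * q <= t < a + (n%:~R + 1) * q ->
  periodize g t = g (t - n%:~R * q) + n%:~R * q.
Proof. by move=> /cell_uniq h; rewrite /periodize h. Qed.

Lemma periodizeD g t : periodize g (t + q) = periodize g t + q.
Proof.
set n := Num.floor ((t - a) / q).
have h := cell_itv t; rewrite -/(n) /cell -/n in h.
rewrite (periodizeE _ h) (@periodizeE _ (n + 1)) intrD; last first.
  by move: h => /andP[h1 h2]; apply/andP; split; nra.
by rewrite mulrDl mul1r opprD addrACA subrr addr0 addrA.
Qed.

Section Homeo.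
Variable g : homeo R.
Hypotheses (gP : is_Pplus g) (gS : supported_cell g).

Lemma supported_cellV : supported_cell (homeo_inv g).
Proof. by move=> t h; rewrite -{1}(gS h) homeoK. Qed.

Lemma periodize_itv n t : a + n%:~R * q <= t < a + (n%:~R + 1) * q ->
  a + n%:~R * q <= periodize g t < a + (n%:~R + 1) * q.
Proof.
move=> h; rewrite (periodizeE _ h); have gi := Pplus_increasing gP.
have gL : {mono g : x y / x <= y} by apply: le_mono.
have h1 : g a = a by apply: gS; left.
have h2 : g (a + q) = a + q by apply: gS; right.
have := gL a (t - n%:~R * q); have := leW_mono gL (t - n%:~R * q) (a + q).
rewrite h1 h2 => e1 e2; move/andP: h => [k1 k2].
have {}e1 : g (t - n%:~R * q) < a + q by rewrite e1; lra.
have {}e2 : a <= g (t - n%:~R * q) by rewrite e2; lra.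
by apply/andP; split; lra.
Qed.

Lemma periodize_increasing : {homo periodize g : x y / x < y}.
Proof.
move=> s t st; have hs := cell_itv s; have ht := cell_itv t.
rewrite /cell in hs ht; move: hs ht.
set n := Num.floor _ => hs; set m := Num.floor _ => ht.
have : n <= m.
  by rewrite -ltzD1 -(ltr_int R) intrD -(ltr_pM2r q_gt0); lra.
rewrite le_eqVlt => /orP[/eqP nm|nm].
  rewrite -nm in ht; rewrite (periodizeE _ hs) (periodizeE _ ht).
  by rewrite ltrD2r (Pplus_increasing gP)// ltrD2r.
have {}nm : (n%:~R + 1) * q <= m%:~R * q.
  by rewrite (ler_pM2r q_gt0) -[1]/(1%:~R) -intrD ler_int lezD1.
have := periodize_itv hs; have := periodize_itv ht.
by move=> /andP[k1 k2] /andP[k3 k4]; lra.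
Qed.

(* Near [t] the periodization only involves the two copies of [g] living on the
   two cells that meet a neighbourhood of [t]. *)
Lemma periodize_local t : exists n, \forall s \near t, periodize g s =
  (transl (n%:~R * q) * g * transl (- (n%:~R * q)) *
   (transl ((n - 1)%:~R * q) * g * transl (- ((n - 1)%:~R * q))))%g s.
Proof.
have := cell_itv t; rewrite /cell; set n := Num.floor _ => /andP[h1 h2]; exists n.
near=> s.
have s1 : a + (n%:~R - 1) * q < s.
  by near: s; apply: lt_nbhsr; lra.
have s2 : s < a + (n%:~R + 1) * q by near: s; apply: lt_nbhsl.
rewrite /= intrB; have [ns|ns] := leP (a + n%:~R * q) s.
  rewrite (periodizeE _ _ (n := n)) ?ns//.
  rewrite (gS (t := s - (n%:~R - 1) * q)) ?subrK//; right; lra.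
have hs : a + (n - 1)%:~R * q <= s < a + ((n - 1)%:~R + 1) * q.
  by rewrite intrB subrK (ltW s1).
have := periodize_itv hs; rewrite (periodizeE _ hs) intrB => /andP[_ k].
by rewrite [in RHS]gS ?subrK//; left; lra.
Unshelve. all: by end_near. Qed.

Lemma periodize_continuous : continuous (periodize g).
Proof.
move=> t; have [n h] := periodize_local t.
rewrite /prop_for /continuous_at (nbhs_singleton h).
apply: cvg_trans (@homeo_continuous _ _ t).
by apply: near_eq_cvg; apply: filterS h.
Qed.

End Homeo.

Lemma periodizeK (g : homeo R) : is_Pplus g -> supported_cell g ->
  cancel (periodize g) (periodize (homeo_inv g)).
Proof.
move=> gP gS t; have := cell_itv t; rewrite /cell; set n := Num.floor _ => h.
rewrite (periodizeE _ (periodize_itv gP gS h)) (periodizeE _ h).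
by rewrite addrK homeoK subrK.
Qed.

Lemma periodize_homeo (g : homeo R) : is_Pplus g -> supported_cell g ->
  dyadic q -> exists2 f : homeo R, is_Pplus f & f =1 periodize g.
Proof.
move=> gP gS Dq.
have gP' : is_Pplus (homeoV g) := is_PplusV gP.
have gS' : supported_cell (homeoV g) := supported_cellV gS.
exists (Homeo (periodizeK gP gS) (periodizeK gP' gS')
  (periodize_continuous gP gS) (periodize_continuous gP' gS')) => //.
apply: is_Pplus_local; first exact: periodize_increasing.
move=> x; have [n h] := periodize_local gP gS x; eexists; last exact: h.
have D (i : int) : dyadic (i%:~R * q) by apply: dyadicM => //; exact: dyadic_int.
have T (i : int) := transl_Pplus (D i).
have T' (i : int) := transl_Pplus (dyadicN (D i)).
by repeat (apply: is_PplusM => //).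
Qed.

End Periodize.

(** * Periodic maps and elements of [H] *)

Section Periodic.
Variable R : realType.
Implicit Types (q : nat) (f g : R -> R) (t : R).

Definition periodic q f := forall t, f (t + q%:R) = f t + q%:R.

Lemma periodic_int q f : periodic q f ->
  forall (n : int) t, f (t + n%:~R * q%:R) = f t + n%:~R * q%:R.
Proof.
move=> fq.
have P (n : nat) t : f (t + n%:R * q%:R) = f t + n%:R * q%:R.
  elim: n t => [|n IH] t; first by rewrite mul0r !addr0.
  by rewrite -addn1 natrD mulrDl mul1r addrA fq IH addrA.
case=> n t; first exact: P.
rewrite NegzE intrN mulNr; apply/(addIr (n.+1%:R * q%:R)).
by rewrite -P !subrK.
Qed.

Lemma periodic_comp q f g : periodic q f -> periodic q g -> periodic q (f \o g).
Proof. by move=> fq gq t; rewrite /= gq fq. Qed.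

Lemma periodic_mul q (n : nat) f : periodic q f -> periodic (n * q)%N f.
Proof. by move=> fq t; rewrite natrM (periodic_int fq n). Qed.

Lemma periodic_eq q f g x : (0 < q)%N -> periodic q f -> periodic q g ->
  (forall t, x <= t < x + q%:R -> f t = g t) -> f =1 g.
Proof.
move=> q0 fq gq h t.
have q0' : (0 : R) < q%:R by rewrite ltr0n.
have := cell_itv x q0' t; set n := Num.floor _ => k.
have -> : t = t - n%:~R * q%:R + n%:~R * q%:R by rewrite subrK.
rewrite (periodic_int fq) (periodic_int gq) h//.
by move: k; rewrite mulrDl mul1r; lra.
Qed.

Lemma Hper_mk q (f : homeo R) : (0 < q)%N -> is_Pplus f -> periodic q f ->
  exists2 h : Hper R, h =1 f :> (R -> R) & periodic q h.
Proof.
move=> q0 /asboolP fP fq.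
have fH : in_Hper (MkPplus fP) by apply/asboolP; exists q.
by exists (MkHper fH).
Qed.

Lemma Hper_ext (f g : Hper R) : f =1 g :> (R -> R) -> f = g.
Proof. by move=> fg; do 2!apply: val_inj; exact: homeo_ext. Qed.

Lemma HperM (f g : Hper R) t : (f * g)%g t = f (g t). Proof. by []. Qed.
Lemma HperVK (f : Hper R) t : f (f^-1%g t) = t. Proof. exact: homeoVK. Qed.
Lemma HperK (f : Hper R) t : f^-1%g (f t) = t. Proof. exact: homeoK. Qed.

Lemma Hper_inj (f : Hper R) : injective f. Proof. exact: can_inj (HperK f). Qed.

Lemma periodicV q (f : Hper R) : periodic q f -> periodic q f^-1%g.
Proof. by move=> fq t; apply: (@Hper_inj f); rewrite fq !HperVK. Qed.

Lemma periodicM q (f g : Hper R) :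
  periodic q f -> periodic q g -> periodic q (f * g)%g.
Proof. exact: periodic_comp. Qed.

End Periodic.

(** * Piecewise affine maps and swaps *)

Section Rep.
Variable R : realType.
Implicit Types (f g : R -> R) (t x y z l m : R) (L M K : seq R).

Definition aff f x l y m := forall t, 0 <= t <= l -> f (x + t) = y + m / l * t.

(* [f] maps the consecutive intervals of lengths [L] starting at [x] affinely
   onto the consecutive intervals of lengths [M] starting at [y]. *)
Fixpoint rep f x L y M : Prop :=
  match L, M with
  | [::], [::] => True
  | l :: L', m :: M' => aff f x l y m /\ rep f (x + l) L' (y + m) M'
  | _, _ => False
  end.

Definition pos L := all (fun l => 0 < l) L.

Lemma pos_sum_ge0 L : pos L -> 0 <= \sum_(l <- L) l.
Proof.
elim: L => [|l L IH] /=; first by rewrite big_nil.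
by move=> /andP[/ltW l0 /IH L0]; rewrite big_cons addr_ge0.
Qed.

Lemma rep_comp f g x L y M z K : pos L -> pos M ->
  rep f x L y M -> rep g y M z K -> rep (g \o f) x L z K.
Proof.
elim: L M K x y z => [|l L IH] [|m M] [|k K] x y z //=.
move=> /andP[l0 L0] /andP[m0 M0] [fa fr] [ga gr]; split; last exact: IH fr gr.
move=> t /andP[t0 tl]; rewrite /= fa ?t0// ga.
  by congr (_ + _); field; rewrite !gt_eqF.
by rewrite mulr_ge0 ?divr_ge0 ?(ltW m0) ?(ltW l0)//= mulrAC ler_pdivrMr// ler_wpM2l// ltW.
Qed.

Lemma aff_id f x l : 0 < l -> (forall t, x <= t <= x + l -> f t = t) ->
  aff f x l x l.
Proof.
move=> l0 h t /andP[t0 tl]; rewrite divff ?gt_eqF// mul1r h//.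
by rewrite lerDl t0 lerD2l tl.
Qed.

Lemma rep_id f x L : pos L -> (forall t, x <= t <= x + \sum_(l <- L) l -> f t = t) ->
  rep f x L x L.
Proof.
elim: L x => [|l L IH] x //= /andP[l0 L0]; rewrite big_cons => h; split.
  by apply: aff_id => // t ht; apply: h; have := pos_sum_ge0 L0; lra.
by apply: IH => // t ht; apply: h; lra.
Qed.

Lemma rep_cat f x L1 L2 y M1 M2 :
  rep f x L1 y M1 -> rep f (x + \sum_(l <- L1) l) L2 (y + \sum_(l <- M1) l) M2 ->
  rep f x (L1 ++ L2) y (M1 ++ M2).
Proof.
elim: L1 M1 x y => [|l L1 IH] [|m M1] x y //=.
  by rewrite !big_nil !addr0.
by move=> [? h1]; rewrite !big_cons !addrA => h2; split => //; exact: IH h1 h2.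
Qed.

Lemma rep_catP f x L1 L2 y M1 M2 : size L1 = size M1 ->
  rep f x (L1 ++ L2) y (M1 ++ M2) ->
  rep f x L1 y M1 /\ rep f (x + \sum_(l <- L1) l) L2 (y + \sum_(l <- M1) l) M2.
Proof.
elim: L1 M1 x y => [|l L1 IH] [|m M1] x y //=.
  by rewrite !big_nil !addr0.
move=> [/IH h] [? /h[h1 h2]]; rewrite !big_cons !addrA; split => //; by split.
Qed.

(** An affine piece maps midpoint to midpoint, so a cell and its image can be halved together. *)
Lemma rep_split f x L1 l L2 y M1 m M2 : size L1 = size M1 -> 0 < l ->
  rep f x (L1 ++ (l + l) :: L2) y (M1 ++ (m + m) :: M2) ->
  rep f x (L1 ++ l :: l :: L2) y (M1 ++ m :: m :: M2).
Proof.
move=> s l0 /(rep_catP s)[h1 [h2 h3]]; apply: rep_cat => //=.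
have lN : l != 0 by rewrite gt_eqF//.
have lN2 : l + l != 0 by rewrite gt_eqF ?addr_gt0.
split; last split.
- by move=> t ht; rewrite h2; [congr (_ + _); field; rewrite lN|lra].
- move=> t ht; rewrite -[X in f X]addrA h2; last lra.
  by rewrite -[RHS]addrA; congr (_ + _); field; rewrite lN.
- by rewrite -!addrA in h3 *.
Qed.

Lemma rep_uniq f g x L y M : pos L -> rep f x L y M -> rep g x L y M ->
  forall t, x <= t < x + \sum_(l <- L) l -> f t = g t.
Proof.
elim: L M x y => [|l L IH] [|m M] x y //=.
  by move=> _ _ _ t; rewrite big_nil addr0 => ?; lra.
move=> /andP[l0 L0] [fa fr] [ga gr] t; rewrite big_cons addrA => /andP[h1 h2].
have [tl|lt] := leP t (x + l); last by apply: (IH _ _ _ L0 fr gr); rewrite h2 ltW.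
have -> : t = x + (t - x) by ring.
by rewrite fa ?ga//; lra.
Qed.

End Rep.

Section Swap.
Variables (R : realType) (q : nat).
Implicit Types (s : R -> R) (a u v x y : R) (L M K : seq R).

(* On each period [s] maps consecutive intervals of lengths [u], [v], from [a],
   onto consecutive intervals of lengths [v], [u], and fixes the rest. *)
Definition is_swap a u v s := periodic q s /\
  rep s a [:: u; v; q%:R - u - v] a [:: v; u; q%:R - u - v].

Definition swappable u v :=
  [/\ dyadic u, 0 < u, exists k : int, v = 2 ^ k * u & u + v < q%:R].

Lemma swap_exists a u v : dyadic a -> swappable u v ->
  exists s : Hper R, is_swap a u v s.
Proof.
move=> Da [Du u0 [k vE] uvq].
have v0 : 0 < v by rewrite vE mulr_gt0// exp2_gt0.
have q0 : (0 : R) < q%:R by lra.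
have Dv : dyadic v by rewrite vE dyadic_exp2M.
have ku : 2 ^ k * u = v by [].
have kv : 2 ^ (- k) * v = u by rewrite vE mulrA -exp2D addNr expr0z mul1r.
have k0 := exp2_gt0 R k.
have kk : (2 : R) ^ (- k) * 2 ^ k = 1 by rewrite -exp2D addNr expr0z.
(* Going right, the kink at [a] gives slope [2 ^ k], so [a + u] goes to [a + v]; the kink there
   changes the slope to [2 ^ (- k)], and the one at [a + u + v], now a fixed point, brings it back
   to 1. *)
pose b : homeo R := (kink (a + u + v) k * (kink (a + v) (- (k + k)) * kink a k))%g.
have bP : is_Pplus b.
  by repeat apply: is_PplusM; apply: kink_Pplus; repeat apply: dyadicD.
have k2 : (2 : R) ^ (- (k + k)) = 2 ^ (- k) * 2 ^ (- k) by rewrite opprD exp2D.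
have b0 t : t <= a -> b t = t.
  by move=> ta; rewrite /= (kinkf_le _ ta) kinkf_le ?kinkf_le//; lra.
have b1 t : 0 <= t <= u -> b (a + t) = a + 2 ^ k * t.
  move=> /andP[t0 tu]; rewrite /= (kinkf_ge (c := a)); last lra.
  have h : 2 ^ k * t <= v by rewrite vE ler_pM2l.
  have -> : a + t - a = t by ring.
  by rewrite [kinkf (a + v) _ _]kinkf_le ?kinkf_le//; lra.
have b2 t : 0 <= t -> kinkf (a + v) (- (k + k)) (kinkf a k (a + u + t)) =
    a + v + 2 ^ (- k) * t.
  move=> t0; rewrite (kinkf_ge (c := a)); last lra.
  have h : 0 <= 2 ^ k * t by rewrite mulr_ge0// ltW.
  have -> : 2 ^ k * (a + u + t - a) = v + 2 ^ k * t by rewrite vE; ring.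
  rewrite kinkf_ge; last lra.
  have -> : a + (v + 2 ^ k * t) - (a + v) = 2 ^ k * t by ring.
  by rewrite k2 -mulrA [X in _ * X]mulrA kk mul1r.
have b3 t : 0 <= t <= v -> b (a + u + t) = a + v + 2 ^ (- k) * t.
  move=> /andP[t0 tv]; rewrite /= b2// kinkf_le//.
  have : 2 ^ (- k) * t <= u by rewrite -[leRHS]kv ler_pM2l// exp2_gt0.
  lra.
have b4 t : a + u + v <= t -> b t = t.
  move=> ht; have -> : t = a + u + (t - a - u) by ring.
  rewrite /= b2; last lra.
  have E : 2 ^ (- k) * (t - a - u) = u + 2 ^ (- k) * (t - a - u - v).
    by rewrite [in RHS]mulrBr kv; ring.
  have h : 0 <= 2 ^ (- k) * (t - a - u - v).
    by rewrite mulr_ge0 ?(ltW (exp2_gt0 _ _))//; lra.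
  rewrite kinkf_ge E; last lra.
  have -> : a + v + (u + 2 ^ (- k) * (t - a - u - v)) - (a + u + v) =
    2 ^ (- k) * (t - a - u - v) by ring.
  by rewrite mulrA -exp2D addrN expr0z mul1r; ring.
have bS : supported_cell a q%:R b by move=> t [/b0//|ht]; apply: b4; lra.
have [f fP fE] := periodize_homeo q0 bP bS (dyadic_nat _ _).
have fq : periodic q f by move=> t; rewrite !fE periodizeD.
have [|h hE hq] := Hper_mk _ fP fq; first by rewrite -(ltr0n R).
have hb t : a <= t < a + q%:R -> h t = b t.
  move=> ht; have := @periodizeE _ a _ q0 b 0 t.
  by rewrite hE fE mulr0z !mul0r subr0 !addr0 add0r mul1r => ->.
have uN : u != 0 by rewrite gt_eqF//.
have vN : v != 0 by rewrite gt_eqF//.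
exists h; split=> //=; split; [|split; [|split=> //]].
- move=> t ht; rewrite hb ?b1//; last by lra.
  by rewrite vE mulfK.
- move=> t ht; rewrite hb ?b3//; last by lra.
  by rewrite -kv mulfK.
(* The closed interval in [aff] contains its right end [a + q], which belongs to the next cell;
   periodicity brings it back to [a]. *)
- move=> t /andP[t0]; rewrite le_eqVlt => /orP[/eqP ->|tq].
    have -> : a + u + v + (q%:R - u - v) = a + q%:R by ring.
    rewrite hq hb ?b0//; last lra.
    by rewrite divff ?mul1r; [ring|rewrite gt_eqF//; lra].
  rewrite hb ?b4; [|lra|lra].
  by rewrite divff ?mul1r; [ring|rewrite gt_eqF//; lra].
Qed.

(* The identity when no element of the group is such a swap. *)
Definition swap a u v : Hper R := xget 1%g [set s : Hper R | is_swap a u v s].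

Lemma swapP a u v : dyadic a -> swappable u v -> is_swap a u v (swap a u v).
Proof.
move=> Da uv; apply: (@xgetPex _ _ [set s : Hper R | is_swap a u v s]).
exact: swap_exists.
Qed.

Lemma periodic_swap a u v : dyadic a -> swappable u v -> periodic q (swap a u v).
Proof. by move=> Da /(swapP Da)[]. Qed.

Lemma swappable_gt0 u v : swappable u v -> 0 < v.
Proof. by move=> [_ u0 [k ->] _]; rewrite mulr_gt0// exp2_gt0. Qed.

Lemma swappableC u v : swappable u v -> swappable v u.
Proof.
move=> uv; have v0 := swappable_gt0 uv; move: uv => [Du u0 [k vE] uvq]; split=> //.
- by rewrite vE dyadic_exp2M.
- by exists (- k); rewrite vE mulrA -exp2D addNr expr0z mul1r.
- by rewrite addrC.
Qed.

Lemma swap_id a u v : dyadic a -> swappable u v ->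
  forall t, a + u + v <= t <= a + q%:R -> swap a u v t = t.
Proof.
move=> Da uv t ht; have [_ /= [_ [_ [h _]]]] := swapP Da uv.
have [_ _ _ uvq] := uv.
have := h (t - a - u - v); rewrite divff ?mul1r; last by rewrite gt_eqF//; lra.
have -> : a + u + v + (t - a - u - v) = t by ring.
by move=> ->; [ring|lra].
Qed.

Lemma swap_id_le a u v : dyadic a -> swappable u v ->
  forall t, a + u + v - q%:R <= t <= a -> swap a u v t = t.
Proof.
move=> Da uv t ht; apply: (addIr q%:R); rewrite -(periodic_swap Da uv).
by apply: swap_id => //; lra.
Qed.

Lemma rep_swap x y L u v M : dyadic x -> swappable u v -> pos L -> pos M ->
  x = y + \sum_(l <- L) l -> \sum_(l <- L ++ u :: v :: M) l = q%:R ->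
  rep (swap x u v) y (L ++ u :: v :: M) y (L ++ v :: u :: M).
Proof.
move=> Dx uv L0 M0 xE; rewrite big_cat !big_cons /= => S.
have SM := pos_sum_ge0 M0; have SL := pos_sum_ge0 L0.
have [_ /= [h1 [h2 _]]] := swapP Dx uv.
apply: rep_cat.
  by apply: rep_id => // t; rewrite -xE => ht; apply: swap_id_le => //; lra.
rewrite -xE; split=> //; split=> //.
rewrite [x + v + u]addrAC; apply: rep_id => // t ht.
by apply: swap_id => //; lra.
Qed.

(** Identities between products of swaps are verified with this: both sides are periodic, and over
    one period the same two lists of lengths describe them. *)
Lemma rep_eq (f g : Hper R) x L y M : (0 < q)%N -> pos L -> \sum_(l <- L) l = q%:R ->
  periodic q f -> periodic q g -> rep f x L y M -> rep g x L y M -> f = g.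
Proof.
move=> q0 L0 S fq gq fr gr; apply/Hper_ext/(periodic_eq q0 fq gq).
by move=> t; rewrite -S; exact: rep_uniq fr gr t.
Qed.

Lemma rep_mul (f g : Hper R) x L y M z K :
  rep g x L y M -> rep f y M z K -> pos L -> pos M -> rep (f * g)%g x L z K.
Proof. by move=> gr fr L0 M0; exact: rep_comp gr fr. Qed.

Lemma rep1 x L : pos L -> rep (1%g : Hper R) x L x L.
Proof. by move=> L0; exact: rep_id. Qed.

Lemma swapK a u v : (0 < q)%N -> dyadic a -> swappable u v ->
  (swap a v u * swap a u v = 1)%g.
Proof.
move=> q0 Da uv; have vu := swappableC uv; have v0 := swappable_gt0 uv.
have [_ u0 _ uvq] := uv.
have [p1 r1] := swapP Da uv; have [p2 r2] := swapP Da vu.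
have P : pos [:: u; v; q%:R - u - v] by rewrite /= u0 v0; lra.
have P' : pos [:: v; u; q%:R - u - v] by rewrite /= u0 v0; lra.
apply: (@rep_eq _ _ a [:: u; v; q%:R - u - v] a [:: u; v; q%:R - u - v]) => //.
- by rewrite !big_cons big_nil; ring.
- exact: periodicM.
- apply: (rep_comp P P' r1).
  by move: r2; rewrite [q%:R - v - u]addrAC.
- exact: rep1.
Qed.

End Swap.

(** * Balanced sequences of pairs of exponents *)

Lemma ltn_sum_seq (T : eqType) (F G : T -> nat) (s : seq T) (p : T) :
  {in s, forall x, F x <= G x}%N -> p \in s -> (F p < G p)%N ->
  (\sum_(x <- s) F x < \sum_(x <- s) G x)%N.
Proof.
move=> FG ps lt; rewrite !(big_rem p ps) /= -addSn leq_add//.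
by rewrite big_seq [leqRHS]big_seq leq_sum// => x /mem_rem /FG.
Qed.

Section PairLists.
Local Open Scope nat_scope.
(** Up to scale, a pair [(a, b)] stands for a cell of length [2 ^ a] mapped affinely onto one of
    length [2 ^ b]; [P s] will say that maps of shape [s] lie in [N]. The closure hypotheses are
    used backwards, to reduce a shape to simpler ones. *)
Variable P : seq (nat * nat) -> Prop.
Implicit Types (s t : seq (nat * nat)) (a b : nat).

Hypothesis P_swap : forall s1 p p' s2, P (s1 ++ p :: p' :: s2) -> P (s1 ++ p' :: p :: s2).

Lemma perm_invariant s t : perm_eq s t -> P s -> P t.
Proof.
have front p s1 s2 r : P (r ++ s1 ++ p :: s2) -> P (r ++ p :: s1 ++ s2).
  elim: s1 r => [//|p' s1 IH] r; rewrite cat_cons -cat_rcons => /IH.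
  by rewrite cat_rcons => /P_swap.
suff gen r : perm_eq s t -> P (r ++ s) -> P (r ++ t) by apply: (gen [::]).
elim: t s r => [|p t IH] s r; first by move/perm_nilP->.
move=> st; have ps : p \in s by rewrite (perm_mem st) mem_head.
case/splitPr: ps st => s1 s2; rewrite -cat1s perm_catCA cat1s perm_cons => st.
by move/front; rewrite -!cat_rcons; apply: IH.
Qed.

Hypothesis P_exchange : forall a b a' b' s,
  P ((a, b') :: (a', b) :: s) -> P ((a, b) :: (a', b') :: s).
Hypothesis P_split : forall a b s, P ((a, b) :: (a, b) :: s) -> P ((a.+1, b.+1) :: s).
Hypothesis P_diag : forall s, all (fun p => p.1 == p.2) s -> P s.

(** The measure of the induction: the total source length of the off-diagonal pairs. Splitting a
    pair preserves it, as [2 ^ a.+1] is twice [2 ^ a]. *)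
Let excess s := \sum_(p <- s | p.1 != p.2) 2 ^ p.1.

Lemma perm_excess s t : perm_eq s t -> excess s = excess t.
Proof. exact: perm_big. Qed.

Let excess_cons p s : excess (p :: s) = (p.1 != p.2) * 2 ^ p.1 + excess s.
Proof. by rewrite /excess big_cons; case: ifP => _; rewrite ?mul1n ?mul0n. Qed.

(* Splitting the pair that carries the larger of [a] and [b'] eventually makes
   them equal; exchanging then creates a diagonal pair and lowers the excess. *)
Lemma exchange_step n :
  (forall s, excess s < n ->
    \sum_(p <- s) 2 ^ p.1 = \sum_(p <- s) 2 ^ p.2 -> P s) ->
  forall d a b a' b' s, a < b -> b' < a' -> (a - b') + (b' - a) = d ->
  excess ((a, b) :: (a', b') :: s) = n ->
  \sum_(p <- (a, b) :: (a', b') :: s) 2 ^ p.1 = \sum_(p <- (a, b) :: (a', b') :: s) 2 ^ p.2 ->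
  P ((a, b) :: (a', b') :: s).
Proof.
(* Subtraction being truncated, [d] is the distance between [a] and [b']; each split lowers it by
   one. *)
move=> IH; elim=> [|d IHd] a b a' b' s ab ba' hd; rewrite !excess_cons !big_cons /= => hn hs.
  have e : b' = a by lia.
  subst b'; apply: P_exchange; apply: IH; last by rewrite !big_cons /=; lia.
  rewrite -hn !excess_cons /= eqxx.
  have -> : a != b by lia.
  have -> : a' != a by lia.
  by have := expn_gt0 2 a; case: (a' != b); lia.
have [ab'|b'a] := ltnP a b'.
  case: a' b' ba' hd hn hs ab' => [|a'] [|b'] // ba' hd hn hs ab'.
  have p1 r : perm_eq ((a'.+1, b'.+1) :: (a, b) :: r) ((a, b) :: (a'.+1, b'.+1) :: r).
    by apply/permP => f /=; lia.
  apply: (perm_invariant (p1 s)); apply: P_split.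
  have p2 : perm_eq ((a, b) :: (a', b') :: (a', b') :: s) [:: (a', b'), (a', b'), (a, b) & s].
    by apply/permP => f /=; lia.
  apply: (perm_invariant p2); apply: IHd; try lia.
    rewrite -hn !excess_cons /= expnS eqSS; case: (a != b); case: (a' != b'); lia.
  by rewrite !big_cons /=; rewrite !expnS in hs; lia.
case: a b ab hd hn hs b'a => [|a] [|b] // ab hd hn hs b'a; first lia.
apply: P_split.
have p2 : perm_eq ((a, b) :: (a', b') :: (a, b) :: s) [:: (a, b), (a, b), (a', b') & s].
  by apply/permP => f /=; lia.
apply: (perm_invariant p2); apply: IHd; try lia.
  rewrite -hn !excess_cons /= expnS eqSS; case: (a' != b'); case: (a != b); lia.
by rewrite !big_cons /=; rewrite !expnS in hs; lia.
Qed.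

Lemma balanced_ind s : \sum_(p <- s) 2 ^ p.1 = \sum_(p <- s) 2 ^ p.2 -> P s.
Proof.
have [n] := ubnP (excess s); elim: n s => // n IH s; rewrite ltnS => hn hs.
have [/P_diag//|/allPn[p ps pN]] := boolP (all (fun p => p.1 == p.2) s).
(* Otherwise [y.2 <= y.1] for all pairs, strictly at the off-diagonal [p], and the two sums would
   differ. The pair [y] with [y.2 < y.1] is then found in the same way from [x]. *)
have [x xs x12] : exists2 x, x \in s & x.1 < x.2.
  apply/hasP; apply: contraT => /hasPn h.
  have h' : {in s, forall y, y.2 <= y.1} by move=> y /h; rewrite -leqNgt.
  have := @ltn_sum_seq _ (fun y => 2 ^ y.2) (fun y => 2 ^ y.1) _ _ _ ps.
  rewrite hs ltnn ltn_exp2l// ltn_neqAle eq_sym pN h'// => -> //.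
  by move=> y /h'; rewrite leq_exp2l.
have [y ys y21] : exists2 y, y \in s & y.2 < y.1.
  apply/hasP; apply: contraT => /hasPn h.
  have h' : {in s, forall y, y.1 <= y.2} by move=> y /h; rewrite -leqNgt.
  have := @ltn_sum_seq _ (fun y => 2 ^ y.1) (fun y => 2 ^ y.2) _ _ _ xs.
  rewrite hs ltnn ltn_exp2l// x12 => -> //.
  by move=> y /h'; rewrite leq_exp2l.
have [r sr] : exists r, perm_eq (x :: y :: r) s.
  have yx : y \in rem x s.
    move: ys; rewrite (perm_mem (perm_to_rem xs)) inE => /orP[/eqP yx|//].
    by move: y21; rewrite yx; lia.
  exists (rem y (rem x s)).
  rewrite perm_sym; apply: (perm_trans (perm_to_rem xs)).
  by rewrite perm_cons; exact: perm_to_rem.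
apply: (perm_invariant sr); case: x y x12 y21 sr {xs ys} => [a b] [a' b'] /= ab ba' sr.
apply: (exchange_step (n := excess s)) => //.
- by move=> t ht; apply: IH; exact: leq_trans ht hn.
- exact: perm_excess.
- by rewrite !(perm_big _ sr).
Qed.

End PairLists.

(** * Commutators modulo a normal subgroup *)

Section Congruence.
Local Open Scope group_scope.
Variables (G : groupType) (N : set G).
Hypothesis N_normal : normal_subgroup N.
Implicit Types x y z : G.

Lemma normal1 : N 1. Proof. by case: N_normal => [[/set_mem]]. Qed.

Lemma normalV x : N x -> N x^-1.
Proof.
by case: N_normal => [[/set_mem N1 NB] _] Nx; apply/set_mem; rewrite -[x^-1]mul1g NB ?inE.
Qed.

Lemma normalM x y : N x -> N y -> N (x * y).
Proof.
move=> Nx /normalV Ny; case: N_normal => [[_ NB] _]; apply/set_mem.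
by rewrite -(invgK y) NB ?inE.
Qed.

Lemma normalJ x y : N x -> N (y * x * y^-1).
Proof.
move=> Nx; case: N_normal => _ /(_ x y^-1 Nx).
by rewrite conjgE invgK mulgA.
Qed.

Lemma normalJE x y : N (y * x * y^-1) -> N x.
Proof. by move/(@normalJ _ y^-1); rewrite invgK !mulgA mulVg mul1g mulgVK. Qed.

Definition cong x y := N (x * y^-1).

Lemma cong_sym x y : cong x y -> cong y x.
Proof. by move/normalV; rewrite invgM invgK. Qed.

Lemma cong_trans x y z : cong x y -> cong y z -> cong x z.
Proof. by move=> xy yz; have := normalM xy yz; rewrite mulgA mulgVK. Qed.

Lemma congM x x' y y' : cong x x' -> cong y y' -> cong (x * y) (x' * y').
Proof.
move=> xx' yy'; have := normalM (normalJ x yy') xx'.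
by rewrite /cong invgM !mulgA mulgVK.
Qed.

Lemma cong_normal x y : cong x y -> N y -> N x.
Proof. by move=> xy /(normalM xy); rewrite mulgVK. Qed.

Lemma normal_mulr x y : N y -> N (x * y) -> N x.
Proof. by move=> /normalV Ny /normalM/(_ Ny); rewrite mulgK. Qed.

Lemma normal_mull x y : N x -> N (x * y) -> N y.
Proof. by move=> /normalV Nx /(normalM Nx); rewrite mulKg. Qed.

End Congruence.

(** * Supports, displaced strips and commutators in [N] *)

Section Displacement.
Variables (R : realType) (N : set (Hper R)) (q : nat).
Hypothesis N_normal : normal_subgroup N.
Hypothesis q_gt0 : (0 < q)%N.
Implicit Types (A B : set R) (f g h : Hper R) (a b t u v w : R).

Definition supp_in f A := forall t, ~ A t -> f t = t.

Lemma supp_in_stable f A t : supp_in f A -> A t -> A (f t).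
Proof.
move=> fA At; apply: contrapT => nA; have := fA _ nA.
by move/Hper_inj => e; rewrite e in nA.
Qed.

Lemma disjoint_commute f g A B : supp_in f A -> supp_in g B ->
  (forall t, A t -> ~ B t) -> (f * g = g * f)%g.
Proof.
move=> fA gB AB; apply: Hper_ext => t; rewrite !HperM.
have [At|nAt] := pselect (A t).
  by rewrite (gB t) ?(gB (f t))//; apply: AB => //; exact: supp_in_stable.
rewrite (fA t)//; have [Bt|nBt] := pselect (B t); last by rewrite gB// fA.
by rewrite fA// => /AB; apply; exact: supp_in_stable.
Qed.

Lemma supp_inJ f g A B : supp_in f A -> (forall t, A t -> B (g t)) ->
  supp_in (g * f * g^-1)%g B.
Proof.
move=> fA AB t nB; rewrite !HperM fA ?HperVK// => /AB.
by rewrite HperVK.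
Qed.

Lemma supp_inV f A : supp_in f A -> supp_in f^-1%g A.
Proof. by move=> fA t /fA e; rewrite -{1}e HperK. Qed.

(* If [f0] displaces [A], then on [A] the element [g f0 g^-1 f0^-1] of [N] acts
   as [g], and its other factor commutes with everything supported in [A]. *)
Lemma displaced_commutator f0 A g h : N f0 -> (forall t, A t -> ~ A (f0 t)) ->
  supp_in g A -> supp_in h A -> N (g * h * g^-1 * h^-1)%g.
Proof.
move=> Nf0 f0A gA hA; pose g' := (f0 * g^-1 * f0^-1)%g.
have g'A : supp_in g' [set t | A (f0^-1%g t)].
  by apply: supp_inJ (supp_inV gA) _ => t At; rewrite /mkset HperK.
have comm : (h * g' = g' * h)%g.
  apply: disjoint_commute hA g'A _ => t At At'.
  by have := f0A _ At'; rewrite HperVK.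
have Nk : N (g * g')%g.
  rewrite /g' !mulgA; apply: normalM => //; [exact: normalJ|exact: normalV].
clearbody g'; have := normalM N_normal Nk (normalJ N_normal h (normalV N_normal Nk)).
congr (N _); rewrite invgM !mulgA; congr (_ * _ * _)%g.
by rewrite -(mulgA g) -comm !mulgA mulgK.
Qed.

(** The preimage in the line of the arc [[a, a + w]] of the circle of length [q]. *)
Definition strip a w : set R := [set t | exists n : int, a <= t + n%:~R * q%:R <= a + w].

(** The displacement of [x0] is not a multiple of [q], so by continuity a short interval close to
    [x0] is moved off all its translates by multiples of [q]. *)
Lemma strip_displaced f0 x0 : periodic q f0 ->
  f0 x0 != x0 -> `|f0 x0 - x0| < q%:R -> exists b, exists k : nat,
  dyadic b /\ forall t, strip b (2 ^- k) t -> ~ strip b (2 ^- k) (f0 t).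
Proof.
move=> fq fx dq; set d := f0 x0 - x0.
have d0 : 0 < `|d| by rewrite normr_gt0 subr_eq0.
(* The minimum is the distance from [d] to the multiples of [q]; a quarter of it leaves room for two
   errors below [e], one in the domain and one in the image. *)
pose e := Num.min `|d| (q%:R - `|d|) / 4.
have e0 : 0 < e by rewrite divr_gt0// lt_min d0 subr_gt0.
have e1 : e <= `|d| / 4 by rewrite /e ler_pM2r ?invr_gt0// ge_min lexx.
have e2 : e <= (q%:R - `|d|) / 4 by rewrite /e ler_pM2r ?invr_gt0// ge_min lexx orbT.
have := @homeo_continuous _ f0 x0 => /cvgrPdist_lt/(_ e e0)/nbhs_ballP[r /= r0 hr].
pose s := Num.min r e.
have s0 : 0 < s by rewrite lt_min r0.
have sr : s <= r by rewrite ge_min lexx.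
have se : s <= e by rewrite ge_min lexx orbT.
have [b Db /andP[b1 b2]] := @dyadic_dense R x0 (x0 + s / 2) ltac:(lra).
have [k hk] := @exp2_small R (s / 2) ltac:(lra).
exists b, k; split=> // t [n hn] [m hm].
set y := t + n%:~R * q%:R in hn; set z := f0 t + m%:~R * q%:R in hm.
have near w : b <= w <= b + 2 ^- k -> `|x0 - w| < s.
  by move=> ?; rewrite distrC ltr_distl; lra.
have fy : f0 y = f0 t + n%:~R * q%:R by exact: periodic_int.
have hy : `|f0 x0 - f0 y| < e by apply: hr; rewrite /ball /=; apply: lt_le_trans sr; exact: near.
have hz : `|x0 - z| < e by apply: lt_le_trans se; exact: near.
have E : (m - n)%:~R * q%:R = z - f0 y by rewrite fy /z intrB; ring.
have q0 : (0 : R) < q%:R by rewrite ltr0n.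
have F : z - f0 y = - d + ((f0 x0 - f0 y) - (x0 - z)) by rewrite /d; ring.
have hF : `|(f0 x0 - f0 y) - (x0 - z)| < 2 * e.
  by rewrite (le_lt_trans (ler_normB _ _))//; lra.
have : `|z - f0 y| < q%:R.
  by rewrite F (le_lt_trans (ler_normD _ _))// normrN; lra.
(* A multiple of [q] smaller than [q] in absolute value is 0. Then [d] equals the error term, which
   is below [2 * e], hence at most half of [|d|]: a contradiction. *)
rewrite -E normrM [X in _ * X]gtr0_norm// -ltr_pdivlMr// divff ?gt_eqF//.
rewrite -intr_norm -[1]/(1%:~R) ltr_int => mn.
have {}mn : m - n = 0 by apply/eqP; move: mn; rewrite -[1]add0r ltzD1 normr_le0.
move: E; rewrite mn mulr0z mul0r F => E.
have {}E : d = (f0 x0 - f0 y) - (x0 - z) by lra.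
by rewrite -E in hF; lra.
Qed.

Lemma transl_exists d : dyadic d ->
  exists2 T : Hper R, (forall t, T t = t + d) & periodic q T.
Proof.
move=> Dd; have Tq : periodic q (transl d).
  by move=> t; rewrite /= addrAC.
by have [T TE Tp] := Hper_mk q_gt0 (transl_Pplus Dd) Tq; exists T.
Qed.

Variables (f0 : Hper R) (x0 : R).
Hypotheses (Nf0 : N f0) (f0_periodic : periodic q f0).
Hypotheses (f0_moves : f0 x0 != x0) (f0_short : `|f0 x0 - x0| < q%:R).

(** The displaced strip may be very short. A swap followed by a translation contracts the strip of
    length 1/2 into it, and [N] is stable under conjugation. *)
Lemma strip_commutator a g h : dyadic a ->
  supp_in g (strip a 2^-1) -> supp_in h (strip a 2^-1) -> N (g * h * g^-1 * h^-1)%g.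
Proof.
move=> Da ga ha.
have [b [k [Db hb]]] := strip_displaced f0_periodic f0_moves f0_short.
have q1 : (1 : R) <= q%:R by rewrite ler1n.
(* Then [w <= 1/4], so [1/2 + w] is less than [q] even when [q] is 1. *)
pose w : R := 2 ^- (k + 2).
have wE : w = 2 ^- k / 4.
  by rewrite /w exprD invfM; congr (_ * _); rewrite -natrX.
have k1 : (2 : R) ^- k <= 1 by rewrite invf_le1 ?exprn_gt0// exprn_ege1// ler1n.
have k0 : (0 : R) < 2 ^- k by rewrite invr_gt0 exprn_gt0.
have sw : swappable q (2^-1) w.
  split; [exact: dyadic_half|lra| |lra].
  exists (- (Posz k) - 1); rewrite exp2D wE -exprnN -mulrA; congr (_ * _).
  by rewrite exprN1; field.
have [sq /= [sa _]] := swapP Da sw.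
have [T TE Tq] := transl_exists (dyadicB Db Da).
pose c := (T * swap q a 2^-1 w)%g.
have cq : periodic q c by exact: periodicM.
have cS t : strip a 2^-1 t -> strip b (2 ^- k) (c t).
  move=> [n hn]; exists n; rewrite -(periodic_int cq).
  set s := t + _ in hn *; have -> : s = a + (s - a) by ring.
  rewrite /c HperM TE sa; last lra.
  have -> : w / 2^-1 * (s - a) = 2 ^- k / 2 * (s - a) by rewrite wE; move: (2 ^- k) => e; field.
  move: k0; set e := 2 ^- k => e0.
  have h1 : 0 <= e / 2 * (s - a) by apply: mulr_ge0; lra.
  have h2 : e / 2 * (s - a) <= e by nra.
  by lra.
apply: (@normalJE _ _ N_normal _ c).
have := displaced_commutator Nf0 hb (supp_inJ ga cS) (supp_inJ ha cS).
by congr (N _); rewrite !invgM !invgK !mulgA !mulgVK.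
Qed.

End Displacement.

(** * Relations between swaps *)

Ltac list_lra := rewrite /pos /= ?big_cons ?big_nil; lra.

Section Relations.
Variables (R : realType) (N : set (Hper R)) (q : nat).
Hypothesis N_normal : normal_subgroup N.
Hypothesis q_gt0 : (0 < q)%N.
Implicit Types (a b c l m p r u v x y Q : R).

Local Notation sw := (swap q).
Local Notation "x ≡ y" := (cong N x y) (at level 70).

Let q_ge1 : 1 <= q%:R :> R. Proof. by rewrite ler1n. Qed.

Lemma swap_supp_in a b u v w : dyadic a -> swappable q u v ->
  b <= a -> a + u + v <= b + w -> supp_in (sw a u v) (strip q b w).
Proof.
have q1 := q_ge1; move=> Da uv ba ab t nS.
have q0 : (0 : R) < q%:R by lra.
have := cell_itv a q0 t; set n := Num.floor _ => /andP[h1 h2].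
apply: (addIr ((- n)%:~R * q%:R)); rewrite -(periodic_int (periodic_swap Da uv)).
have {}h2 : t + (- n)%:~R * q%:R <= a + q%:R.
  by move: h2; rewrite intrN mulNr mulrDl mul1r; lra.
apply: swap_id => //; rewrite h2 andbT leNgt; apply/negP => h3.
by apply: nS; exists (- n); move: h1 h3; rewrite intrN mulNr; lra.
Qed.

Lemma swappableM u v (k : int) : swappable q u v -> 2 ^ k * (u + v) < q%:R ->
  swappable q (2 ^ k * u) (2 ^ k * v).
Proof.
move=> [Du u0 [j ->] _] h; split; last by rewrite -mulrDr.
- by rewrite dyadic_exp2M.
- by rewrite mulr_gt0// exp2_gt0.
- by exists j; rewrite mulrCA.
Qed.

Lemma swappableD u v : swappable q u v -> u + u + (v + v) < q%:R ->
  swappable q (u + u) (v + v).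
Proof.
move=> uv h; have := @swappableM _ _ 1 uv; rewrite expr1z !mulrDl !mul1r.
by apply; lra.
Qed.

Lemma swappable_dbl u v : swappable q u v -> u + (v + v) < q%:R -> swappable q u (v + v).
Proof.
move=> [Du u0 [k ->] _] h; split=> //.
by exists (k + 1); rewrite exp2D expr1z; ring.
Qed.

Lemma swappable_half u v : swappable q u v -> swappable q (u / 2) (v / 2).
Proof.
move=> uv; have := @swappableM _ _ (-1) uv; rewrite exprN1 ![2^-1 * _]mulrC; apply.
by have [_ u0 _ h] := uv; have := swappable_gt0 uv; lra.
Qed.

Lemma swappable_refl u : dyadic u -> 0 < u -> u + u < q%:R -> swappable q u u.
Proof. by move=> Du u0 h; split=> //; exists 0; rewrite expr0z mul1r. Qed.

Lemma aff_sub (f : R -> R) x l y m x' l' y' m' : aff f x l y m ->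
  x <= x' -> 0 < l' -> x' + l' <= x + l -> y' = y + m / l * (x' - x) ->
  m' = m / l * l' -> aff f x' l' y' m'.
Proof.
move=> h xx' l0 xl -> -> t ht.
have -> : x' + t = x + (x' - x + t) by ring.
by rewrite h ?mulfK ?gt_eqF//; [ring|lra].
Qed.

Lemma rep_swap0 y u v L : dyadic y -> swappable q u v -> pos L ->
  u + v + \sum_(l <- L) l = q%:R -> rep (sw y u v) y [:: u, v & L] y [:: v, u & L].
Proof.
move=> Dy uv L0 S; apply: (@rep_swap _ q y y [::]) => //.
  by rewrite big_nil addr0.
by rewrite /= !big_cons addrA.
Qed.

Lemma rep_swap1 y l u v L : dyadic (y + l) -> swappable q u v -> 0 < l -> pos L ->
  l + u + v + \sum_(l <- L) l = q%:R ->
  rep (sw (y + l) u v) y [:: l, u, v & L] y [:: l, v, u & L].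
Proof.
move=> Dy uv l0 L0 S; apply: (@rep_swap _ q _ y [:: l]) => //.
- by rewrite /= l0.
- by rewrite big_seq1.
- by rewrite /= !big_cons !addrA.
Qed.

Lemma rep_swap2 y l l' u v L : dyadic (y + (l + l')) -> swappable q u v ->
  0 < l -> 0 < l' -> pos L -> l + l' + u + v + \sum_(l <- L) l = q%:R ->
  rep (sw (y + (l + l')) u v) y [:: l, l', u, v & L] y [:: l, l', v, u & L].
Proof.
move=> Dy uv l0 l'0 L0 S; apply: (@rep_swap _ q _ y [:: l; l']) => //.
- by rewrite /= l0 l'0.
- by rewrite !big_cons big_nil addr0.
- by rewrite /= !big_cons !addrA.
Qed.

(* Conjugating by the contraction, which is [x |-> (c + x) / 2] on [c, c + 1/4],
   halves a swap and moves it to the left. *)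
Definition contraction c := sw c 4^-1 8^-1.

Lemma contraction_swappable : swappable q (4^-1 : R) 8^-1.
Proof.
have q1 := q_ge1; split; [|lra| |lra].
  by have -> : (4^-1 : R) = 2^-1 * 2^-1 by [field]; apply: dyadicM; exact: dyadic_half.
by exists (-1); rewrite exprN1; field.
Qed.

(** [A] and [B] pad the two intervals to fill [[c, c + 1/4]], where the slope is 1/2; [Q] is the
    part of the period that stays fixed. *)
Lemma rep_contraction c A p r B Q : dyadic c ->
  [/\ 0 < A, 0 < p, 0 < r & 0 < B] -> A + p + p + r + r + B = 4^-1 ->
  Q = q%:R - 4^-1 - 8^-1 ->
  rep (contraction c) c [:: A; p + p; r + r; B; 8^-1; Q]
    c [:: A / 2; p; r; B / 2; 4^-1; Q].
Proof.
have q1 := q_ge1; move=> Dc [A0 p0 r0 B0] S QE.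
have [_ /= [h1 [h2 [h3 _]]]] := swapP Dc contraction_swappable.
split; [|split; [|split; [|split; [|split; [|split; [|by []]]]]]].
- by apply: aff_sub h1 _ _ _ _ _ => //; lra.
- by apply: aff_sub h1 _ _ _ _ _ => //; lra.
- by apply: aff_sub h1 _ _ _ _ _ => //; lra.
- by apply: aff_sub h1 _ _ _ _ _ => //; lra.
- by apply: aff_sub h2 _ _ _ _ _ => //; lra.
- have e : Q / Q = 1 by rewrite divff// gt_eqF//; lra.
  by apply: aff_sub h3 _ _ _ _ _; rewrite -?QE ?e; lra.
Qed.

(** The choice [c = 2 b - a] makes [(c + a) / 2] equal to [b]. The bounds keep the larger swap
    inside [[c, c + 1/4]], where the contraction halves lengths. *)
Lemma contraction_conj a b u v : dyadic a -> dyadic b -> swappable q u v ->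
  b < a -> u + v <= 64^-1 -> a - b <= 16^-1 ->
  (contraction (b + b - a) * sw a (u + u) (v + v) =
   sw b u v * contraction (b + b - a))%g.
Proof.
have q1 := q_ge1; move=> Da Db uv ba uvs ab; set c := b + b - a.
have Dc : dyadic c by apply: dyadicB => //; exact: dyadicD.
have [_ u0 _ _] := uv; have v0 := swappable_gt0 uv.
have uv2 : swappable q (u + u) (v + v) by apply: swappableD => //; lra.
pose A := a - c; pose B := 4^-1 - A - (u + u) - (v + v).
pose Q : R := q%:R - 4^-1 - 8^-1.
have A0 : 0 < A by rewrite /A /c; lra.
have B0 : 0 < B by rewrite /B /A /c; lra.
have Q0 : 0 < Q by rewrite /Q; lra.
have AE : c + A = a by rewrite /A; ring.
have AE' : c + A / 2 = b by rewrite /A /c; field.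
have BE : A + u + u + v + v + B = 4^-1 by rewrite /B; ring.
have QE : 4^-1 + 8^-1 + Q = q%:R by rewrite /Q; ring.
have c1 := @rep_contraction c A u v B Q Dc.
have c2 := @rep_contraction c A v u B Q Dc.
move: (A) (B) (Q) A0 B0 Q0 AE AE' BE QE c1 c2 => {}A {}B {}Q A0 B0 Q0 AE AE' BE QE.
move=> /(_ ltac:(by split)) /(_ ltac:(lra)) /(_ ltac:(lra)) c1.
move=> /(_ ltac:(by split)) /(_ ltac:(lra)) /(_ ltac:(lra)) c2.
have cq : periodic q (contraction c) by exact: periodic_swap contraction_swappable.
apply: (@rep_eq _ q _ _ c [:: A; u + u; v + v; B; 8^-1; Q]
  c [:: A / 2; v; u; B / 2; 4^-1; Q]) => //.
- by rewrite /pos /=; lra.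
- by rewrite !big_cons big_nil; lra.
- by apply: periodicM => //; exact: periodic_swap.
- by apply: periodicM => //; exact: periodic_swap.
- have r := @rep_swap1 c A (u + u) (v + v) [:: B; 8^-1; Q].
  rewrite AE in r; have {}r := r Da uv2 A0 ltac:(list_lra) ltac:(list_lra).
  by apply: rep_mul r c2 _ _; list_lra.
- have r := @rep_swap1 c (A / 2) u v [:: B / 2; 4^-1; Q].
  rewrite AE' in r; have {}r := r Db uv ltac:(lra) ltac:(list_lra) ltac:(list_lra).
  by apply: rep_mul c1 r _ _; list_lra.
Qed.

(* Subdividing both intervals turns one exchange into four. *)
Lemma swap_subdivide a u v : dyadic a -> swappable q u v -> u + u + (v + v) < q%:R ->
  (sw (a + v) u v * (sw (a + (v + u)) u v * (sw a u v * sw (a + u) u v)) =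
   sw a (u + u) (v + v))%g.
Proof.
have q1 := q_ge1; move=> Da uv uvq; have [Du u0 _ _] := uv.
have v0 := swappable_gt0 uv; have [Dv _ _ _] := swappableC uv.
have uv2 : swappable q (u + u) (v + v) by exact: swappableD.
pose Q := q%:R - (u + u + (v + v)); have Q0 : 0 < Q by rewrite /Q; lra.
have QE : u + u + v + v + Q = q%:R by rewrite /Q; ring.
move: (Q) Q0 QE => {}Q Q0 QE.
have D1 : dyadic (a + u) by exact: dyadicD.
have D2 : dyadic (a + v) by exact: dyadicD.
have D3 : dyadic (a + (v + u)) by do 2!apply: dyadicD => //.
apply: (@rep_eq _ q _ _ a [:: u; u; v; v; Q] a [:: v; v; u; u; Q]) => //.
- by list_lra.
- by list_lra.
- by repeat apply: periodicM; apply: periodic_swap.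
- exact: periodic_swap.
- have r1 := rep_swap1 D1 uv u0 (L := [:: v; Q]) ltac:(list_lra) ltac:(list_lra).
  have r2 := rep_swap0 Da uv (L := [:: u; v; Q]) ltac:(list_lra) ltac:(list_lra).
  have r3 := rep_swap2 D3 uv v0 u0 (L := [:: Q]) ltac:(list_lra) ltac:(list_lra).
  have r4 := rep_swap1 D2 uv v0 (L := [:: u; Q]) ltac:(list_lra) ltac:(list_lra).
  have r21 := rep_mul r1 r2 ltac:(list_lra) ltac:(list_lra).
  have r321 := rep_mul r21 r3 ltac:(list_lra) ltac:(list_lra).
  exact: rep_mul r321 r4 ltac:(list_lra) ltac:(list_lra).
- have := rep_swap0 Da uv2 (L := [:: Q]) ltac:(list_lra) ltac:(list_lra).
  move=> /(@rep_split _ _ _ [:: u + u] v [:: Q] _ [:: v + v]) => /(_ erefl v0).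
  by move/(@rep_split _ _ _ [::] u [:: v; v; Q] _ [::]) => /(_ erefl u0).
Qed.

(** On an interval of length [4 u] this is, up to inversion, the standard generator of Thompson's
    group F, which maps pieces of lengths 1/2, 1/4, 1/4 onto pieces of lengths 1/4, 1/4, 1/2. *)
Definition rotation a u := (sw (a + u) (u + u) u * sw a (u + u) u)%g.

Lemma rotation_swappable u : dyadic u -> 0 < u -> u + u + u < q%:R ->
  swappable q (u + u) u.
Proof.
move=> Du u0 uq; split=> //; [exact: dyadicD|lra|exists (-1)].
by rewrite exprN1; field.
Qed.

Lemma rep_rotation a u M : dyadic a -> dyadic u -> 0 < u -> pos M -> 0 < \sum_(l <- M) l ->
  u + u + u + u + \sum_(l <- M) l = q%:R ->
  rep (rotation a u) a [:: u + u, u, u & M] a [:: u, u, u + u & M].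
Proof.
move=> Da Du u0 M0 SM0 S; have uv : swappable q (u + u) u.
  by apply: rotation_swappable => //; lra.
have Dau : dyadic (a + u) by exact: dyadicD.
have r1 := rep_swap0 Da uv (L := u :: M) ltac:(by rewrite /= u0) ltac:(rewrite big_cons; lra).
have r2 := rep_swap1 Dau uv u0 M0 ltac:(lra).
by rewrite /rotation; apply: rep_mul r1 r2 _ _; rewrite /= u0 M0 ?andbT; lra.
Qed.

Lemma periodic_rotation a u : dyadic a -> dyadic u -> 0 < u -> u + u + u < q%:R ->
  periodic q (rotation a u).
Proof.
move=> Da Du u0 uq; have uv := rotation_swappable Du u0 uq.
by apply: periodicM; apply: periodic_swap => //; exact: dyadicD.
Qed.

(* The relation [x^2 = x_0 x x_1] of Thompson's group F between the rotation at
   the root of a binary tree and those at its two children. *)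
Lemma pentagon a u : dyadic a -> dyadic u -> 0 < u -> 8 * u < q%:R ->
  (rotation a (u + u) * rotation a (u + u) =
   rotation a u * rotation a (u + u) * rotation (a + 4 * u) u)%g.
Proof.
move=> Da Du u0 uq; pose Q := q%:R - 8 * u; have Q0 : 0 < Q by rewrite /Q; lra.
have QE : 8 * u + Q = q%:R by rewrite /Q; ring.
move: (Q) Q0 QE => {}Q Q0 QE.
pose w := u + u; have Dw : dyadic w by exact: dyadicD.
have w0 : 0 < w by rewrite /w; lra.
have Da4 : dyadic (a + (w + w)) by do 2!apply: dyadicD => //.
have -> : 4 * u = w + w by rewrite /w; ring.
have uv : swappable q w u by apply: rotation_swappable => //; lra.
have rw (M : seq R) := @rep_rotation a w M Da Dw w0.
have ru (M : seq R) := @rep_rotation a u M Da Du u0.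
apply: (@rep_eq _ q _ _ a [:: w + w; w; u; u; Q] a [:: u; u; w; w + w; Q]) => //.
- by rewrite /w; list_lra.
- by rewrite /w; list_lra.
- by apply: periodicM; apply: periodic_rotation => //; rewrite /w; lra.
- by apply: periodicM; [apply: periodicM|]; apply: periodic_rotation => //; rewrite /w; lra.
- have r := rw [:: Q]
    ltac:(rewrite /w; list_lra) ltac:(rewrite /w; list_lra) ltac:(rewrite /w; list_lra).
  have r1 := @rep_split _ _ _ [:: w + w; w] u [:: Q] _ [:: w; w] w [:: Q] erefl u0 r.
  have r2 := @rep_split _ _ _ [::] w [:: w; w; Q] _ [::] u [:: w; w + w; Q] erefl w0 r.
  by apply: rep_mul r1 r2 _ _; rewrite /w; list_lra.
- have r1 : rep (rotation (a + (w + w)) u) a [:: w + w; w; u; u; Q] a [:: w + w; u; u; w; Q].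
    have s1 := @rep_swap1 a (w + w) w u [:: u; Q] Da4 uv
      ltac:(lra) ltac:(list_lra) ltac:(rewrite /w; list_lra).
    have Da5 : dyadic (a + (w + w + u)) by rewrite addrA; exact: dyadicD.
    have s2 := @rep_swap2 a (w + w) u w u [:: Q] Da5 uv
      ltac:(lra) ltac:(lra) ltac:(list_lra) ltac:(rewrite /w; list_lra).
    by rewrite /rotation -[a + (w + w) + u]addrA; apply: rep_mul s1 s2 _ _; rewrite /w; list_lra.
  have r2 := rw [:: Q]
    ltac:(rewrite /w; list_lra) ltac:(rewrite /w; list_lra) ltac:(rewrite /w; list_lra).
  have {}r2 := @rep_split _ _ _ [:: w + w] u [:: w; Q] _ [:: w] u [:: w + w; Q] erefl u0 r2.
  have r3 := ru [:: w + w; Q]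
    ltac:(rewrite /w; list_lra) ltac:(rewrite /w; list_lra) ltac:(rewrite /w; list_lra).
  rewrite -mulgA.
  have r21 := rep_mul r1 r2 ltac:(rewrite /w; list_lra) ltac:(rewrite /w; list_lra).
  by apply: rep_mul r21 r3 _ _; rewrite /w; list_lra.
Qed.

(* Two ways of moving an interval of length [l + l] across two of length [m]
   that get merged and halved on the way. *)
Lemma hexagon a l m : dyadic a -> swappable q m l -> m + m + (l + l) < q%:R ->
  (sw (a + l) (m + m) l * (sw a (m + m) l * (sw a (l + l) (m + m) *
    (sw a m (l + l) * sw (a + m) m (l + l)))) = sw a (m + m) (l + l))%g.
Proof.
move=> Da ml mlq; pose Q := q%:R - (m + m + (l + l)).
have Q0 : 0 < Q by rewrite /Q; lra.
have QE : m + m + (l + l) + Q = q%:R by rewrite /Q; ring.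
move: (Q) Q0 QE => {}Q Q0 QE.
have m0 : 0 < m by case: ml.
have l0 := swappable_gt0 ml.
have ml2 := swappableD ml mlq; have lm2 := swappableC ml2.
have m1l2 : swappable q m (l + l) by apply: swappable_dbl => //; lra.
have m2l1 : swappable q (m + m) l.
  by apply: swappableC; apply: swappable_dbl; [exact: swappableC|lra].
have Dal : dyadic (a + l) by apply: dyadicD => //; case: (swappableC ml).
have Dam : dyadic (a + m) by apply: dyadicD => //; case: ml.
apply: (@rep_eq _ q _ _ a [:: m; m; l + l; Q] a [:: l; l; m + m; Q]) => //.
- by list_lra.
- by list_lra.
- by repeat apply: periodicM; apply: periodic_swap.
- exact: periodic_swap.
- have r1 := rep_swap1 Dam m1l2 m0 (L := [:: Q]) ltac:(list_lra) ltac:(list_lra).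
  have r2 := rep_swap0 Da m1l2 (L := [:: m; Q]) ltac:(list_lra) ltac:(list_lra).
  have r3 := rep_swap0 Da lm2 (L := [:: Q]) ltac:(list_lra) ltac:(list_lra).
  have {}r3 := @rep_split _ _ _ [:: l + l] m [:: Q] _ [:: m + m] l [:: Q] erefl m0 r3.
  have r4 := rep_swap0 Da m2l1 (L := [:: l; Q]) ltac:(list_lra) ltac:(list_lra).
  have r5 := rep_swap1 Dal m2l1 l0 (L := [:: Q]) ltac:(list_lra) ltac:(list_lra).
  have r := rep_mul r1 r2 ltac:(list_lra) ltac:(list_lra).
  have {}r := rep_mul r r3 ltac:(list_lra) ltac:(list_lra).
  have {}r := rep_mul r r4 ltac:(list_lra) ltac:(list_lra).
  exact: rep_mul r r5 ltac:(list_lra) ltac:(list_lra).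
- have r := rep_swap0 Da ml2 (L := [:: Q]) ltac:(list_lra) ltac:(list_lra).
  exact: (@rep_split _ _ _ [::] m [:: l + l; Q] _ [::] l [:: m + m; Q] erefl m0 r).
Qed.

Lemma swap_diag a u : dyadic a -> dyadic u -> 0 < u -> u + u < q%:R -> sw a u u = 1%g.
Proof.
move=> Da Du u0 uq; have uu := swappable_refl Du u0 uq.
have [sq sr] := swapP Da uu.
apply: (@rep_eq _ q _ _ a [:: u; u; q%:R - u - u] a [:: u; u; q%:R - u - u]) => //.
- by list_lra.
- by list_lra.
- by apply: rep1; list_lra.
Qed.

Hypothesis strip_comm : forall a g h, dyadic a ->
  supp_in g (strip q a 2^-1) -> supp_in h (strip q a 2^-1) -> N (g * h * g^-1 * h^-1)%g.

(** By [contraction_conj] the two swaps are conjugate, so their quotient is a commutator of the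
    contraction with a swap, both supported in one strip of length 1/2. *)
Lemma swap_halve_cong a b u v : dyadic a -> dyadic b -> swappable q u v ->
  u + v <= 64^-1 -> 0 <= b -> b < a -> a <= 16^-1 ->
  sw a (u + u) (v + v) ≡ sw b u v.
Proof.
have q1 := q_ge1; move=> Da Db uv uvs b0 ba a1; apply: cong_sym => //.
have [_ u0 _ _] := uv; have v0 := swappable_gt0 uv.
(* The strip is [[-1/16, 7/16]]: the contraction starts at [b + b - a], which lies between [-1/16]
   and [1/16], and its support has length [3/8]. *)
have D16 : dyadic (- 16^-1 : R).
  by apply: dyadicN; have := dyadic_exp2V R 4; rewrite -natrX.
have h := contraction_conj Da Db uv ba uvs ltac:(lra).
set c := contraction _ in h *; set S := sw a _ _ in h *.
rewrite /cong -[sw b u v](mulgK c) -h; apply: (strip_comm D16).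
  apply: swap_supp_in; [|exact: contraction_swappable|lra|lra].
  by apply: dyadicB => //; exact: dyadicD.
apply: swap_supp_in => //; [|lra|lra].
by apply: swappableD => //; lra.
Qed.

(** Both swaps are halves of one doubled swap, placed at [1/16] to the right of both. *)
Lemma swap_position_cong b b' u v : dyadic b -> dyadic b' -> swappable q u v ->
  u + v <= 64^-1 -> 0 <= b <= 32^-1 -> 0 <= b' <= 32^-1 ->
  sw b u v ≡ sw b' u v.
Proof.
move=> Db Db' uv uvs hb hb'.
have D16 : dyadic (16^-1 : R) by have := dyadic_exp2V R 4; rewrite -natrX.
apply: (cong_trans N_normal (y := sw 16^-1 (u + u) (v + v))).
  by apply: cong_sym => //; apply: swap_halve_cong => //; lra.
by apply: swap_halve_cong => //; lra.
Qed.

Let D64 : dyadic (64^-1 : R).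
Proof. by have := dyadic_exp2V R 6; rewrite -natrX. Qed.

(** In [swap_subdivide] the doubled swap and the four small ones are all congruent to [g], so
    [g ^ 4] is congruent to [g]. At position [1/64] the doubled swap can be moved left to 0, and the
    small ones still start before [1/32]. *)
Lemma swap_cube u v : swappable q u v -> u + v <= 128^-1 ->
  N (sw 0 u v * (sw 0 u v * sw 0 u v))%g.
Proof.
have q1 := q_ge1; move=> uv uvs; have [Du u0 _ _] := uv; have v0 := swappable_gt0 uv.
have [Dv _ _ _] := swappableC uv; have D0 := dyadic0 R.
have := @swap_subdivide 64^-1 u v D64 uv ltac:(lra); set g := sw 0 u v => E.
have P b : dyadic b -> 0 <= b <= 32^-1 -> g ≡ sw b u v.
  by move=> Db hb; apply: swap_position_cong => //; lra.
have : (g * (g * (g * g)))%g ≡ g.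
  apply: (cong_trans N_normal (y := sw 64^-1 (u + u) (v + v))).
    have D1 := dyadicD D64 Dv; have D2 := dyadicD D64 (dyadicD Dv Du).
    have D3 := dyadicD D64 Du.
    by rewrite -E; do 3?[apply: congM => //]; apply: P => //; lra.
  by apply: swap_halve_cong => //; lra.
by rewrite /cong !mulgA mulgK.
Qed.

(** Each rotation is a product of two swaps congruent to [g]. With [y = g * g], [pentagon] says that
    [y ^ 2] is congruent to [y ^ 3]. *)
Lemma swap_dbl_square u : dyadic u -> 0 < u -> 3 * u <= 128^-1 ->
  N (sw 0 (u + u) u * sw 0 (u + u) u)%g.
Proof.
have q1 := q_ge1; move=> Du u0 us; have D0 := dyadic0 R.
have uv : swappable q (u + u) u by apply: rotation_swappable => //; lra.
set g := sw 0 (u + u) u; have D2 : dyadic (u + u) by exact: dyadicD.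
have D4 : dyadic (4 * u) by apply: dyadicM => //; exact: dyadic_nat.
have P1 b : dyadic b -> 0 <= b -> b + u <= 32^-1 -> rotation b u ≡ (g * g)%g.
  move=> Db b0 hb; apply: congM => //; apply: swap_position_cong => //; try lra.
  exact: dyadicD.
have P2 : rotation 64^-1 (u + u) ≡ (g * g)%g.
  apply: congM => //; apply: swap_halve_cong => //; try lra.
  exact: dyadicD.
have := @pentagon 64^-1 u D64 Du u0 ltac:(lra).
set x := rotation _ (u + u) => E.
have : (g * g * (g * g))%g ≡ (g * g * (g * g) * (g * g))%g.
  apply: (cong_trans N_normal (y := (x * x)%g)).
    by apply: cong_sym => //; exact: congM.
  have D3 := dyadicD D64 D4.
  rewrite E; apply: congM => //; last by apply: P1 => //; lra.
  by apply: congM => //; apply: P1 => //; lra.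
move: (g * g)%g => y; rewrite /cong (invgM (y * y)%g y) mulgA => /(normalJE N_normal).
by move/(normalV N_normal); rewrite invgK.
Qed.

(* Let [g_k] be the class modulo [N] of the small swaps of ratio [2 ^ - k].  Then
   [g_k ^ 3 = 1] by [swap_cube], [g_1 ^ 2 = 1] by [swap_dbl_square], and
   [g_(k + 2) ^ 2 = 1] as soon as [g_k = g_(k + 1) = 1], by [hexagon]. *)
Lemma swap_pow2_normal (k : nat) u v : dyadic u -> 0 < u -> v = 2 ^ (- k%:Z) * u ->
  u + v <= 128^-1 -> N (sw 0 u v).
Proof.
have q1 := q_ge1; have D0 := dyadic0 R.
(* The recurrence reaches back two exponents, so [k] and [k.+1] are carried together. *)
suff : (forall u v, dyadic u -> 0 < u -> v = 2 ^ (- k%:Z) * u ->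
    u + v <= 128^-1 -> N (sw 0 u v)) /\
  (forall u v, dyadic u -> 0 < u -> v = 2 ^ (- k.+1%:Z) * u ->
    u + v <= 128^-1 -> N (sw 0 u v)) by case=> h _; exact: h.
elim: k {u v} => [|k [IH0 IH1]].
  split=> u v Du u0 ->.
    by rewrite oppr0 expr0z mul1r => us; rewrite swap_diag//; [exact: normal1|lra].
  rewrite exprN1 mulrC => us; have Du2 : dyadic (u / 2).
    by apply: dyadicM => //; exact: dyadic_half.
  have -> : u = u / 2 + u / 2 by field.
  have -> : (u / 2 + u / 2) / 2 = u / 2 by field.
  have sq := @swap_dbl_square (u / 2) Du2 ltac:(lra) ltac:(lra).
  have uv : swappable q (u / 2 + u / 2) (u / 2) by apply: rotation_swappable => //; lra.
  exact: normal_mulr sq (swap_cube uv ltac:(lra)).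
split=> // u v Du u0 vE us.
have e2 : (2 : R) ^ (- k.+2%:Z) = 2 ^ (- k%:Z) / 4.
  by rewrite -[k.+2]addn2 PoszD opprD exp2D -[2 ^ (- 2%:Z)]exprnN -natrX.
have e1 : (2 : R) ^ (- k.+1%:Z) = 2 ^ (- k%:Z) / 2.
  by rewrite -[k.+1]addn1 PoszD opprD exp2D exprN1.
have uv : swappable q u v by split=> //; [exists (- k.+2%:Z)|lra].
have v0 := swappable_gt0 uv.
(* With [m = u / 4] and [l = v / 2], the swaps of [m + m] and [l] in [hexagon] have the ratio
   [v / u] under study; all others have ratio [2 ^ - k], or [2 ^ - k.+1] or its inverse, and lie in
   [N] by induction. *)
have ml : swappable q (u / 2 / 2) (v / 2).
  have [_ _ _ h] := swappable_half uv.
  split; [|lra| |lra].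
    exact: dyadicM (dyadicM Du (dyadic_half R)) (dyadic_half R).
  by exists (- k.+1%:Z); rewrite vE e2 e1; move: (2 ^ _) => e; field.
set m := u / 2 / 2 in ml; set l := v / 2 in ml.
have [Dm m0 _ _] := ml; have l0 := swappable_gt0 ml; have [Dl _ _ _] := swappableC ml.
have mE : m + m = u / 2 by rewrite /m; field.
have lE : l + l = v by rewrite /l; field.
have ml2 : swappable q (m + m) (l + l) by apply: swappableD => //; lra.
have N6 : N (sw 0 (m + m) (l + l)).
  apply: IH1; [exact: dyadicD|lra| |lra].
  by rewrite lE mE vE e1 e2; move: (2 ^ _) => e; field.
have N2 : N (sw 0 m (l + l)).
  by apply: IH0 => //; [rewrite lE vE e2 /m; move: (2 ^ _) => e; field|lra].
have N1 : N (sw (0 + m) m (l + l)).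
  apply: (cong_normal N_normal _ N2); apply: swap_position_cong => //; rewrite ?add0r//; try lra.
  by apply: swappable_dbl => //; lra.
have N3 : N (sw 0 (l + l) (m + m)).
  apply: (normal_mulr N_normal N6); rewrite swapK//; exact: normal1.
have := hexagon D0 ml ltac:(lra); set g := sw 0 u v => E.
have P b : dyadic b -> 0 <= b <= 32^-1 -> g ≡ sw b (m + m) l.
  have m2l : swappable q (m + m) l.
    by apply: swappableC; apply: swappable_dbl; [exact: swappableC|lra].
  have D32 : dyadic (32^-1 : R) by have := dyadic_exp2V R 5; rewrite -natrX.
  move=> Db hb; apply: (cong_trans N_normal (y := sw 0 (m + m) l)); last first.
    by apply: swap_position_cong => //; lra.
  apply: (cong_trans N_normal (y := sw 32^-1 u v)).
    by apply: swap_position_cong => //; lra.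
  have -> : sw 32^-1 u v = sw 32^-1 (m + m + (m + m)) (l + l).
    by congr (sw _ _ _); rewrite /m /l; field.
  by apply: swap_halve_cong => //; lra.
have gg : N (g * g)%g.
  apply: (cong_normal N_normal (y := sw (0 + l) (m + m) l * sw 0 (m + m) l)%g).
    apply: congM => //; apply: P => //; rewrite ?add0r//; lra.
  move: N6; rewrite -E mulgA; apply: normal_mulr => //.
  by do 2!apply: normalM => //.
exact: normal_mulr gg (swap_cube uv us).
Qed.

Lemma rep_transl (T : R -> R) d x L : (forall t, T t = t + d) -> pos L ->
  rep T x L (x + d) L.
Proof.
move=> TE; elim: L x => //= l L IH x /andP[l0 L0]; split; last first.
  by rewrite addrAC; exact: IH.
by move=> t ht; rewrite TE divff ?mul1r ?gt_eqF//; ring.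
Qed.

(** Swaps of ratio above 1 are inverse to those of ratio below 1, and a translation conjugates the
    swap at 0 to the one at [a]. *)
Lemma small_swap_normal a u v : dyadic a -> swappable q u v -> u + v <= 128^-1 ->
  N (sw a u v).
Proof.
have D0 := dyadic0 R; move=> Da uv uvs.
have N0 : N (sw 0 u v).
  have vu := swappableC uv; have [Du u0 [k vE] uvq] := uv.
  have [k0|/ltW k0] := leP k 0.
    apply: (@swap_pow2_normal `|k|%N) => //.
    by rewrite vE; congr (_ ^ _ * _); rewrite abszE ler0_norm// opprK.
  have [Dv v0 _ _] := vu.
  apply: (@normal_mulr _ _ N_normal _ (sw 0 v u)).
    apply: (@swap_pow2_normal `|k|%N) => //; last by rewrite addrC.
    by rewrite vE mulrA -exp2D abszE ger0_norm// addNr expr0z mul1r.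
  by rewrite swapK//; exact: normal1.
have [T TE Tq] := transl_exists q_gt0 Da.
have [Du u0 _ uvq] := uv; have v0 := swappable_gt0 uv.
have P1 : pos [:: u; v; q%:R - u - v] by list_lra.
have P2 : pos [:: v; u; q%:R - u - v] by list_lra.
have T0 L : pos L -> rep T 0 L a L by move=> L0; have := rep_transl 0 TE L0; rewrite add0r.
have [sq sr] := swapP Da uv; have [sq0 sr0] := swapP D0 uv.
suff -> : sw a u v = (T * sw 0 u v * T^-1)%g by exact: normalJ.
apply: (canRL (mulgK _)); apply: (@rep_eq _ q _ _ 0 _ a _ _ P1) => //.
- by list_lra.
- exact: periodicM.
- exact: periodicM.
- exact: (rep_mul (T0 _ P1) sr P1 P1).
- exact: (rep_mul sr0 (T0 _ P2) P1 P2).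
Qed.

End Relations.

(** * Dyadic grids *)

Section Grid.
Variable R : realType.
Implicit Types (f : R -> R) (a b x : R).

(** The points near which [f] agrees with its affine germ at the midpoint form an open and closed
    subset of the connected open interval; continuity extends the formula to the end points. *)
Lemma affine_on_segment f a b : continuous f -> a < b ->
  (forall x, a < x < b -> exists c, affine_near f c x) ->
  exists c d, affine_near f c ((a + b) / 2) /\ forall x, a <= x <= b -> f x = c * x + d.
Proof.
move=> cf ab fx; pose A : set R := [set x | a < x < b].
have Am : A ((a + b) / 2) by rewrite /A /=; lra.
have [c [d hd]] := fx _ Am.
pose E : set R := [set x | f x = c * x + d]; pose C := interior E.
have AC : A `&` C = A.
  have /connected_intervalP : is_interval A.
    by move=> x y /= /andP[? ?] /andP[? ?] z ?; rewrite /A /=; lra.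
  apply; first by exists ((a + b) / 2); split.
    by exists C => //; exact: open_interior.
  exists (closure C); first exact: closed_closure.
  apply/seteqP; split=> x [Ax Cx]; split=> //; first exact: subset_closure.
  have [c' [d' hd']] := fx _ Ax.
  have [y [Cy hy]] := Cx _ (nbhs_interior hd').
  have cc : c = c' by apply: (@affine_near_uniq _ f _ _ y); [exists d|exists d'].
  suff dd : d = d' by apply: filterS hd' => z; rewrite /E /= cc dd.
  apply: (addrI (c * y)).
  by rewrite -(nbhs_singleton Cy) (nbhs_singleton hy) cc.
have AE : A `<=` E by move=> x Ax; have : (A `&` C) x by [rewrite AC]; move=> [_ /nbhs_singleton].
have clE : closed E.
  rewrite (_ : E = (fun x => f x - (c * x + d)) @^-1` [set 0]); last first.
    by apply/seteqP; split=> x; rewrite /E /= => h; lra.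
  apply: closed_comp => [x _|]; last exact: closed_eq.
  apply: cvgB; first exact: cf.
  by apply: cvgD; [apply: cvgM; [exact: cvg_cst|exact: cvg_id]|exact: cvg_cst].
have clA x : a <= x <= b -> closure A x.
  move=> hx B /nbhs_ballP[e /= e0 eB].
  pose r := Num.min e ((b - a) / 2) / 2.
  have r0 : 0 < r by rewrite divr_gt0// lt_min e0; lra.
  have re : r < e.
    have : Num.min e ((b - a) / 2) <= e by rewrite ge_min lexx.
    by rewrite /r in r0 *; lra.
  have rb : r <= (b - a) / 4.
    have : Num.min e ((b - a) / 2) <= (b - a) / 2 by rewrite ge_min lexx orbT.
    by rewrite /r in r0 *; lra.
  have [h|h] := leP x ((a + b) / 2).
    exists (x + r); split; first by rewrite /A /=; lra.
    by apply: eB; rewrite /ball /= opprD addNKr normrN gtr0_norm.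
  exists (x - r); split; first by rewrite /A /=; lra.
  by apply: eB; rewrite /ball /= opprB addrC subrK gtr0_norm.
exists c, d; split=> [|x /clA Ax]; first by exists d.
by apply: clE; exact: closure_subset AE _ Ax.
Qed.

(* By compactness, all breakpoints in a bounded interval lie on a common dyadic grid. *)
Lemma Pplus_grid (f : homeo R) (q : nat) (e : R) : is_Pplus f -> 0 < e ->
  exists n : nat, 2 ^- n < e /\ forall k : nat, (k < q * 2 ^ n)%N -> exists i : int,
    2 ^ i * 2 ^- n < e /\
    aff f (k%:R * 2 ^- n) (2 ^- n) (f (k%:R * 2 ^- n)) (2 ^ i * 2 ^- n).
Proof.
move=> fP e0; have [_ fd fb fs _] := fP; have cf := @homeo_continuous _ f.
(* The first condition puts breakpoints on the grid of step [2 ^- n]; the second will bound the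
   lengths of the images of the cells. *)
pose P (n : nat) x := (breakpoints f x -> exists m : int, x * 2 ^+ n = m%:~R) /\
  `|f (x + 2 ^- n) - f x| < e.
have : \forall n \near \oo, `[0, q%:R]%classic `<=` P n.
  (* Compactness in covering form: it is enough to have [P n y] for [y] near a given [x] and [n]
     large. There [x] is the only possible breakpoint. *)
  have /compact_near_coveringP := @segment_compact R 0 q%:R.
  apply=> x _.
  have [n0 hn0] : exists n0 : nat, forall n, (n0 <= n)%N -> breakpoints f x ->
      exists m : int, x * 2 ^+ n = m%:~R.
    have [[m [n0 ->]]|nD] := pselect (dyadic x); last by exists 0%N => n _ /fb.
    exists n0 => n nn _; exists (m * 2 ^+ (n - n0)).
    rewrite rmorphM rmorphXn /= -{1}(subnK nn) exprD.
    by field; rewrite expf_neq0// pnatr_eq0.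
  have /cvgrPdist_lt/(_ (e / 2) ltac:(lra))/nbhs_ballP[r /= r0 hr] := cf x.
  have [n1 hn1] := @exp2_small R (r / 2) ltac:(lra).
  have bx : \forall y \near x, y != x -> exists a, affine_near f a y.
    by have /discreteP/(_ x) := fd.
  exists ([set y | (y != x -> exists a, affine_near f a y) /\ `|x - y| < r / 2],
          [set n | (maxn n0 n1 <= n)%N]).
    split; last by exists (maxn n0 n1).
    apply: filterI => //; apply/nbhs_ballP; exists (r / 2) => /=; first lra.
    by move=> y.
  move=> [y n] /= [[yx yr]]; rewrite geq_max => /andP[nn0 nn1]; split.
    by have [->|/yx yN []//] := eqVneq y x; exact: hn0.
  have n1n : (2 : R) ^- n <= 2 ^- n1.
    by rewrite lef_pV2 ?posrE ?exprn_gt0// ler_weXn2l// ler1n.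
  have p0 : (0 : R) < 2 ^- n by rewrite invr_gt0 exprn_gt0.
  have h1 : `|f x - f y| < e / 2 by apply: hr; rewrite /ball /=; lra.
  have h2 : `|f x - f (y + 2 ^- n)| < e / 2.
    apply: hr; rewrite /ball /= opprD addrA (le_lt_trans (ler_normB _ _))//.
    by rewrite [X in _ + X]gtr0_norm//; lra.
  have -> : f (y + 2 ^- n) - f y = (f x - f y) - (f x - f (y + 2 ^- n)) by ring.
  by rewrite (le_lt_trans (ler_normB _ _))//; lra.
have [n1 hn1] := exp2_small e0.
move=> [n2 _ /(_ (maxn n1 n2))]; rewrite /= leq_maxr => /(_ isT).
have : (2 : R) ^- maxn n1 n2 < e.
  by apply: le_lt_trans hn1; rewrite lef_pV2 ?posrE ?exprn_gt0// ler_weXn2l ?ler1n// leq_maxl.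
move: (maxn n1 n2) => n ne hn; exists n; split=> // k kn.
have p0 : (0 : R) < 2 ^- n by rewrite invr_gt0 exprn_gt0.
set x := k%:R * 2 ^- n; set y := x + 2 ^- n.
have pn : (2 : R) ^- n * 2 ^+ n = 1 by rewrite mulVf// expf_neq0// pnatr_eq0.
have x0 : 0 <= x by rewrite mulr_ge0// ltW.
have yq : y <= q%:R.
  rewrite /y /x -[X in _ + X]mul1r -mulrDl natr1.
  by rewrite ler_pdivrMr ?exprn_gt0// -natrX -natrM ler_nat.
have xy : x < y by rewrite /y ltrDl.
have [z hz|c [d [hc hd]]] := affine_on_segment cf xy.
  (* A breakpoint inside the cell would give an integer strictly between [k] and [k.+1]. *)
  apply: contrapT => Bz; have [] := hn z; first by rewrite /= in_itv /=; lra.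
  move=> /(_ Bz)[m hm] _.
  have : k%:~R < m%:~R :> R /\ m%:~R < k.+1%:~R :> R.
    rewrite -hm; have pp : (0 : R) < 2 ^+ n by rewrite exprn_gt0.
    have xE : x * 2 ^+ n = k%:R by rewrite /x -mulrA pn mulr1.
    have yE : y * 2 ^+ n = k.+1%:R by rewrite /y mulrDl xE pn natr1.
    by rewrite -[k%:~R]xE -[k.+1%:~R]yE !ltr_pM2r//; lra.
  by rewrite !ltr_int => -[]; lia.
have [i ci] := fs _ _ hc; exists i; rewrite -ci.
have fy : f y = f x + c * 2 ^- n by rewrite !hd /y; [ring|lra|lra].
split; last first.
  move=> t ht; rewrite mulfK ?gt_eqF// !hd; [ring|lra|].
  by rewrite /y in xy *; lra.
have [_] := hn x ltac:(by rewrite /= in_itv /=; lra).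
by rewrite -/y fy addrAC subrr add0r; apply: le_lt_trans; rewrite ler_norm.
Qed.

End Grid.

(** * Simplicity *)

Section Assembly.
Variables (R : realType) (N : set (Hper R)) (q : nat).
Hypothesis N_normal : normal_subgroup N.
Hypothesis q_gt0 : (0 < q)%N.
Hypothesis strip_comm : forall (a : R) g h, dyadic a ->
  supp_in g (strip q a 2^-1) -> supp_in h (strip q a 2^-1) -> N (g * h * g^-1 * h^-1)%g.
Implicit Types (f g h : Hper R) (s : seq (nat * nat)) (L M : seq R).

Let q_ge1 : 1 <= q%:R :> R. Proof. by rewrite ler1n. Qed.

Lemma rep_sum (f : R -> R) (x : R) L y M : pos L -> f x = y -> rep f x L y M ->
  f (x + \sum_(l <- L) l) = y + \sum_(m <- M) m.
Proof.
elim: L M x y => [|l L IH] [|m M] x y //=; first by rewrite !big_nil !addr0.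
move=> /andP[l0 L0] _ [fa fr]; rewrite !big_cons !addrA; apply: IH => //.
by rewrite fa ?divfK ?gt_eqF//; lra.
Qed.

Section Scale.
Variable W : nat.
Let w : R := 2 ^- W.

Let w0 : 0 < w. Proof. by rewrite invr_gt0 exprn_gt0. Qed.

(** Relative to a scale [w] fine enough for all cells and images, lengths have natural exponents, as
    [balanced_ind] requires. *)
Definition len (a : nat) : R := w * 2 ^+ a.
Definition srcs s := [seq len p.1 | p <- s].
Definition tgts s := [seq len p.2 | p <- s].

Lemma len_gt0 a : 0 < len a. Proof. by rewrite mulr_gt0// exprn_gt0. Qed.

Lemma dyadic_len a : dyadic (len a).
Proof.
rewrite /len /w (_ : 2 ^- W = 2 ^ (- W%:Z)) ?exprnN//.
by rewrite dyadic_exp2M; exact: (dyadic_exp2 _ (Posz a)).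
Qed.

Lemma len_double a : len a.+1 = len a + len a.
Proof. by rewrite /len exprS; ring. Qed.

Lemma pos_len (T : Type) (e : T -> nat) (r : seq T) : pos [seq len (e p) | p <- r].
Proof. by elim: r => //= p r ->; rewrite len_gt0. Qed.

Lemma dyadic_sum (T : Type) (e : T -> nat) (r : seq T) :
  dyadic (\sum_(l <- [seq len (e p) | p <- r]) l).
Proof.
elim: r => [|p r IH] /=; first by rewrite big_nil; exact: dyadic0.
by rewrite big_cons; apply: dyadicD => //; exact: dyadic_len.
Qed.

Lemma swappable_len a b : len a <= 256^-1 -> len b <= 256^-1 ->
  swappable q (len a) (len b).
Proof.
have q1 := q_ge1; move=> ha hb; split; [exact: dyadic_len|exact: len_gt0| |lra].
exists (b%:Z - a%:Z); rewrite exp2D -exprnN /len.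
by rewrite -exprnP; field; rewrite expf_neq0// pnatr_eq0.
Qed.

Lemma swap_len_normal x a b : dyadic x -> len a <= 256^-1 -> len b <= 256^-1 ->
  N (swap q x (len a) (len b)).
Proof.
move=> Dx ha hb; apply: small_swap_normal => //; last lra.
exact: swappable_len.
Qed.

(** Two lengths of at most [1/256] have a sum of at most [1/128], the bound in
    [small_swap_normal]. *)
Definition small s := all (fun p => (len p.1 <= 256^-1) && (len p.2 <= 256^-1)) s.

(* Smallness of the pieces puts all the swaps applied to [f] in [N]. *)
Definition absorbed s := small s -> \sum_(l <- srcs s) l = q%:R ->
  \sum_(l <- tgts s) l = q%:R ->
  forall f, periodic q f -> rep f 0 (srcs s) 0 (tgts s) -> N f.

(** A swap composed before [f] exchanges the two cells, and one composed after it exchanges their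
    images. *)
Lemma absorbed_swap s1 p p' s2 :
  absorbed (s1 ++ p :: p' :: s2) -> absorbed (s1 ++ p' :: p :: s2).
Proof.
move=> IH; rewrite /absorbed /small /srcs /tgts !map_cat /= all_cat /=.
move=> /and4P[sm1 /andP[h1 h2] /andP[h3 h4] sm2] S T f fq fr.
have D0 := dyadic0 R.
pose x := \sum_(l <- [seq len p.1 | p <- s1]) l : R.
pose y := \sum_(l <- [seq len p.2 | p <- s1]) l : R.
have Dx : dyadic x by exact: dyadic_sum.
have Dy : dyadic y by exact: dyadic_sum.
have P1 := @pos_len (nat * nat) (fun p => p.1); have P2 := @pos_len (nat * nat) (fun p => p.2).
have S' : \sum_(l <- [seq len p.1 | p <- s1 ++ p :: p' :: s2]) l = q%:R.
  by rewrite -S map_cat /= !big_cat !big_cons /=; congr (_ + _); exact: addrCA.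
have hr := @rep_swap _ q x 0 [seq len p.1 | p <- s1] (len p.1) (len p'.1)
  [seq len p.1 | p <- s2] Dx (swappable_len h3 h1) (P1 _) (P1 _) (esym (add0r _)).
rewrite map_cat /= in S'; have {}hr := hr S'.
have kr := @rep_swap _ q y 0 [seq len p.2 | p <- s1] (len p'.2) (len p.2)
  [seq len p.2 | p <- s2] Dy (swappable_len h2 h4) (P2 _) (P2 _) (esym (add0r _)) T.
have hN := swap_len_normal Dx h3 h1; have kN := swap_len_normal Dy h2 h4.
have cat1 e : [seq len (e p) | p <- s1] ++ len (e p') :: len (e p) :: [seq len (e p) | p <- s2] =
  [seq len (e p) | p <- s1 ++ p' :: p :: s2] by rewrite map_cat.
have cat2 e : [seq len (e p) | p <- s1] ++ len (e p) :: len (e p') :: [seq len (e p) | p <- s2] =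
  [seq len (e p) | p <- s1 ++ p :: p' :: s2] by rewrite map_cat.
have r1 := rep_mul hr fr ltac:(by rewrite (cat2 fst)) ltac:(by rewrite (cat1 fst)).
have r2 := rep_mul r1 kr ltac:(by rewrite (cat2 fst)) ltac:(by rewrite (cat1 snd)).
have : N (swap q y (len p'.2) (len p.2) * (f * swap q x (len p.1) (len p'.1)))%g.
  apply: IH.
  - by rewrite /small all_cat /= h1 h2 h3 h4 sm1.
  - by rewrite /srcs map_cat.
  - by rewrite /tgts map_cat -T !big_cat !big_cons /=; congr (_ + _); exact: addrCA.
  - by do 2?[apply: periodicM => //]; apply: periodic_swap => //; exact: swappable_len.
  - by rewrite /srcs /tgts !map_cat.
by move=> /(normal_mull N_normal kN); exact: normal_mulr.
Qed.

(** Only the images change places, so a single swap composed after [f] is enough. *)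
Lemma absorbed_exchange a b a' b' s :
  absorbed ((a, b') :: (a', b) :: s) -> absorbed ((a, b) :: (a', b') :: s).
Proof.
move=> IH; rewrite /absorbed /small /srcs /tgts [all _ _]/= !map_cons.
move=> /and3P[/andP[h1 h2] /andP[h3 h4] sm] S T f fq fr.
have D0 := dyadic0 R.
have kr := rep_swap0 D0 (swappable_len h2 h4) (pos_len snd s).
have {}kr := kr ltac:(by rewrite -T !big_cons addrA).
have kN := swap_len_normal D0 h2 h4.
apply: (normal_mull N_normal kN); apply: IH.
- by rewrite /small /= h1 h2 h3 h4.
- exact: S.
- by rewrite /tgts /= -T !big_cons addrCA.
- by apply: periodicM => //; apply: periodic_swap => //; exact: swappable_len.
rewrite /srcs /tgts !map_cons; apply: rep_mul fr kr _ _.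
  exact: (pos_len (fun p => p.1) ((a, b) :: (a', b') :: s)).
exact: (pos_len (fun p => p.2) ((a, b) :: (a', b') :: s)).
Qed.

Lemma absorbed_split a b s :
  absorbed ((a, b) :: (a, b) :: s) -> absorbed ((a.+1, b.+1) :: s).
Proof.
move=> IH; rewrite /absorbed /small /srcs /tgts /= !len_double.
move=> /andP[/andP[h1 h2] sm] S T f fq fr.
have a0 := len_gt0 a; have b0 := len_gt0 b; apply: IH => //.
- by rewrite /small /= sm !andbT; lra.
- by rewrite /srcs /= -S !big_cons addrA.
- by rewrite /tgts /= -T !big_cons addrA.
- exact: (@rep_split _ f 0 [::] _ _ 0 [::] _ _ erefl a0 fr).
Qed.

Lemma absorbed_diag s : all (fun p => p.1 == p.2) s -> absorbed s.
Proof.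
move=> ds _ S _ f fq fr; suff -> : f = 1%g by exact: normal1.
have E : tgts s = srcs s.
  by apply/eq_in_map => p /(allP ds)/eqP ->.
rewrite E in fr; have P1 := pos_len fst s.
exact: (rep_eq q_gt0 P1 S fq _ fr (rep1 _ P1)).
Qed.

Lemma all_absorbed s : absorbed s.
Proof.
move=> sm S T; have bal : (\sum_(p <- s) 2 ^ p.1 = \sum_(p <- s) 2 ^ p.2)%N.
  (* Both total lengths are [q]; cancelling [w] turns this into the equality of natural sums needed
     for [balanced_ind]. *)
  have E (e : nat * nat -> nat) :
      \sum_(l <- [seq len (e p) | p <- s]) l = w * (\sum_(p <- s) 2 ^ e p)%N%:R.
    rewrite big_map natr_sum mulr_sumr; apply: eq_bigr => p _.
    by rewrite /len natrX.
  apply/eqP; rewrite -(eqr_nat R); apply/eqP/(mulfI (lt0r_neq0 w0)).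
  by rewrite -!E; exact: etrans S (esym T).
move: sm S T; apply: (balanced_ind absorbed_swap absorbed_exchange
  absorbed_split absorbed_diag bal).
Qed.

End Scale.

Lemma rep_cells (f : R -> R) (d : R) (m : nat -> R) k0 n : 0 < d ->
  (forall k, (k0 <= k < k0 + n)%N -> aff f (k%:R * d) d (f (k%:R * d)) (m k)) ->
  rep f (k0%:R * d) [seq d | k <- iota k0 n] (f (k0%:R * d)) [seq m k | k <- iota k0 n].
Proof.
move=> d0; elim: n k0 => //= n IH k0 h.
have h0 := h k0 ltac:(lia); split=> //.
have E : k0%:R * d + d = k0.+1%:R * d by rewrite -natr1 mulrDl mul1r.
rewrite E (_ : _ + m k0 = f (k0.+1%:R * d)); last first.
  by rewrite -E h0 ?divfK ?gt_eqF ?lexx ?ltW.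
by apply: IH => k hk; apply: h; lia.
Qed.

Lemma fix0_normal f : periodic q f -> f 0 = 0 -> N f.
Proof.
move=> fq f00; have fP : is_Pplus f by apply/asboolP; exact: (Pplus_homeoP f).
have [n [n1 hn]] := @Pplus_grid R f q 256^-1 fP ltac:(lra).
pose d : R := 2 ^- n; have d0 : 0 < d by rewrite invr_gt0 exprn_gt0.
have /choice[i hi] : forall k, exists j : int, (k < q * 2 ^ n)%N ->
    2 ^ j * d < 256^-1 /\ aff f (k%:R * d) d (f (k%:R * d)) (2 ^ j * d).
  move=> k; have [kn|kn] := boolP (k < q * 2 ^ n)%N; last first.
    by exists 0 => h; case/negP: kn.
  by have [j] := hn _ kn; exists j.
pose r := iota 0 (q * 2 ^ n); pose S := (\sum_(k <- r) `|i k|)%N.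
have iS k : k \in r -> (`|i k| <= S)%N.
  by move=> kr; rewrite /S (big_rem k kr) /= leq_addr.
(* Since [S] bounds every [|i k|], all [S + i k] are nonnegative; at scale [2 ^- (n + S)] the cells
   have exponent [S] and their images [S + i k]. *)
pose W := (n + S)%N; pose s := [seq (S, `|(S%:Z + i k)%R|%N) | k <- r].
have E1 : len W S = d.
  by rewrite /len /W /d exprD; field; rewrite !expf_neq0// pnatr_eq0.
have E2 k : k \in r -> len W `|(S%:Z + i k)%R|%N = 2 ^ (i k) * d.
  move=> /iS kS; have S0 : 0 <= S%:Z + i k by lia.
  by rewrite -E1 /len [X in _ * X = _]exprnP abszE ger0_norm// exp2D -exprnP; ring.
have sE : srcs W s = [seq d | k <- r] by rewrite /srcs -map_comp; apply: eq_map => k /=.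
have tE : tgts W s = [seq 2 ^ (i k) * d | k <- r].
  by rewrite /tgts -map_comp; apply/eq_in_map => k /E2.
have fr : rep f 0 (srcs W s) 0 (tgts W s).
  rewrite sE tE; have := @rep_cells f d (fun k => 2 ^ (i k) * d) 0 (q * 2 ^ n) d0.
  by rewrite mul0r f00; apply=> k kn; have [] := hi k kn.
have S1 : \sum_(l <- srcs W s) l = q%:R.
  rewrite sE big_map big_const_seq count_predT size_iota iter_addr_0 -[LHS]mulr_natr natrM natrX.
  by rewrite mulrCA mulVf ?mulr1// expf_neq0// pnatr_eq0.
apply: (@all_absorbed W s _ _ _ f fq fr) => //.
- rewrite /small all_map; apply/allP => k kr /=; rewrite E1 E2//.
  by have [|h _] := hi k; [rewrite mem_iota in kr|rewrite !ltW].
- have := rep_sum (pos_len W fst s) f00 fr.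
  by rewrite -/(srcs W s) S1 !add0r => <-; rewrite -[in LHS](add0r q%:R) fq f00 add0r.
Qed.

(* A swap in [N] sends [0] to [d], and so differs from the translation by [d] by a
   map that fixes [0]. *)
Lemma transl_grid_normal (d : R) (T : Hper R) : dyadic d -> 0 < d -> 3 * d <= 128^-1 ->
  (forall t, T t = t + d) -> periodic q T -> N T.
Proof.
move=> Dd d0 d1 TE Tq; have q1 := q_ge1.
have uv : swappable q d (d + d).
  by split=> //; [exists 1; rewrite expr1z; ring|lra].
have DN := dyadicN Dd; have [sq /= [sa _]] := swapP DN uv.
have Ns : N (swap q (- d) d (d + d)) by apply: small_swap_normal => //; lra.
suff NT : N (T^-1 * swap q (- d) d (d + d))%g.
  by have := normal_mulr N_normal Ns NT; move/(normalV N_normal); rewrite invgK.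
apply: fix0_normal; first by apply: periodicM => //; exact: periodicV.
rewrite HperM; have := sa d; rewrite addNr => ->; last lra.
have -> : - d + (d + d) / d * d = T 0 by rewrite TE; field; rewrite gt_eqF.
exact: HperK.
Qed.

(** As [f 0] is dyadic, it is a multiple of some small [d]; composing with the translation by [d],
    or its inverse, step by step leads to a map that fixes 0. *)
Lemma periodic_normal f : periodic q f -> N f.
Proof.
move=> fq; have fP : is_Pplus f by apply/asboolP; exact: (Pplus_homeoP f).
have [m [n fE]] : dyadic (f 0).
  by apply/(dyadic_mem (Pplus_dyadic fP)); exact: dyadic0.
(* The 9 extra halvings give [3 * d <= 3/512], within the bound of [transl_grid_normal]. *)
pose d : R := 2 ^- (n + 9).
have d0 : 0 < d by rewrite invr_gt0 exprn_gt0.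
have Dd : dyadic d by exact: dyadic_exp2V.
have d1 : 3 * d <= 128^-1.
  have : (2 : R) ^- n <= 1 by rewrite invf_le1 ?exprn_gt0// exprn_ege1// ler1n.
  rewrite /d exprD invfM; have -> : (2 : R) ^+ 9 = 512 by rewrite -natrX.
  lra.
have [T TE Tq] := transl_exists q_gt0 Dd.
have NT := transl_grid_normal Dd d0 d1 TE Tq.
have {}fE : f 0 = (m * 2 ^+ 9)%:~R * d.
  rewrite fE /d exprD rmorphM rmorphXn /=; field.
  by rewrite !expf_neq0// pnatr_eq0.
have TV t : T^-1%g t = t - d by apply: (@Hper_inj _ T); rewrite HperVK TE subrK.
have gen (k : nat) g : periodic q g -> g 0 = k%:R * d \/ g 0 = - (k%:R * d) -> N g.
  elim: k g => [|k IH] g gq; first by rewrite mul0r oppr0 => -[]; exact: fix0_normal.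
  rewrite -natr1 mulrDl mul1r => -[gE|gE].
    apply: (normal_mull N_normal (normalV N_normal NT)); apply: IH.
      by apply: periodicM => //; exact: periodicV.
    by left; rewrite HperM TV gE addrK.
  apply: (normal_mull N_normal NT); apply: IH; first exact: periodicM.
  by right; rewrite HperM TE gE; ring.
move: fE; case: (m * 2 ^+ 9) => k fE; first by apply: (gen k); [|left].
by apply: (gen k.+1) => //; right; rewrite fE NegzE intrN mulNr.
Qed.

End Assembly.

Theorem theorem2 (R : realType) : simple_group (Hper R).
Proof.
split.
  have [T TE _] := @transl_exists R 1 isT 1 (dyadic_nat _ 1).
  exists T => T1; have := TE 0; rewrite T1 add0r => /eqP.
  by rewrite eq_sym oner_eq0.
move=> N N_normal.
have [[f0 [Nf0 f0N]]|h] := pselect (exists f0, N f0 /\ f0 <> 1%g); last first.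
  left; apply/seteqP; split=> [f Nf|f ->]; last exact: normal1.
  by apply: contrapT => f1; apply: h; exists f.
right; apply/seteqP; split=> // f _.
have [x0 hx0] : exists x0, f0 x0 <> x0.
  apply: contrapT => h; apply: f0N; apply: Hper_ext => t.
  by apply: contrapT => ht; apply: h; exists t.
have /asboolP[p p0 fp] := Hper_PplusP f.
have /asboolP[p' p'0 f0p] := Hper_PplusP f0.
(* [K] exceeds the displacement of [x0], so its product with the two periods is a common period
   longer than that displacement. *)
pose K := Num.bound `|f0 x0 - x0|.
have hK := archi_boundP (normr_ge0 (f0 x0 - x0)).
have K0 : (0 < K)%N by rewrite -(ltr0n R) (le_lt_trans _ hK).
pose q := (K * (p * p'))%N; have q0 : (0 < q)%N by rewrite !muln_gt0 K0 p0.
have fq : periodic q f by rewrite /q [(p * p')%N]mulnC mulnA; exact: periodic_mul.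
have f0q : periodic q f0 by rewrite /q mulnA; exact: periodic_mul.
have dq : `|f0 x0 - x0| < q%:R.
  by apply: lt_le_trans hK _; rewrite ler_nat leq_pmulr// muln_gt0 p0.
apply: (@periodic_normal _ _ q) => //.
move=> a g h; apply: (strip_commutator N_normal q0 Nf0 f0q _ dq).
exact/eqP.
Qed.
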